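(* Let $r\ge2$ and let $G=M_{p_1,\dots,p_r}$ be the multi-fan graph. Let $p=\sum_{i\in[r]}p_i$ and $S=K[x_v,y_v : v\in V(G)]$. Then $$\operatorname{Hilb}_{S/J_G}(t)=\frac{(1+t)^{p-r}}{(1-t)^{p+r}}+\frac{(p-1)t^2+2t}{(1-t)^{p+2}}.$$ In particular, $\dim(S/J_G)=p+r$ and $$e(S/J_G)=\begin{cases}2^{p-r} & \text{if } r>2,\\ 2^{p-r}+p+1 & \text{if } r=2.\end{cases}$$
   Context: $K$ is a field and $S$ is standard graded. $P_s$ denotes the path on $s\ge1$ vertices. The multi-fan graph $M_{p_1,\dots,p_r}$ is the join $\{v\}*(\sqcup_{i=1}^rP_{p_i})$ of a single vertex $v$ with the disjoint union of the paths $P_{p_1},\dots,P_{p_r}$, i.e. the disjoint union of the paths together with a new vertex $v$ adjacent to all path vertices. The binomial edge ideal of a simple graph $G$ (with totally ordered vertex set) is $J_G=(x_iy_j-x_jy_i : \{i,j\}\in E(G),\ i<j)$. $\operatorname{Hilb}_M(t)=\sum_{k\ge0}\dim_K(M_k)t^k$ is the Hilbert series, $\dim$ is Krull dimension, and $e(M)$ is the multiplicity: if $\operatorname{Hilb}_M(t)=Q(t)/(1-t)^d$ with $d=\dim M$ and $Q$ a polynomial, then $e(M)=Q(1)$. *)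

(* Defs.v *)
From HB Require Import structures.
From mathcomp Require Import all_boot all_order all_algebra.
From mathcomp Require Import mpoly.
From mathcomp Require boolp.

Set Implicit Arguments.
Unset Strict Implicit.
Unset Printing Implicit Defensive.

Import GRing.Theory.
Local Open Scope ring_scope.
Local Open Scope quotient_scope.

Definition path_graph (s : nat) : rel 'I_s :=
  fun a b => ((a : nat).+1 == b) || ((b : nat).+1 == a).

Definition disjoint_union (I : finType) (T : I -> finType)
    (G : forall i, rel (T i)) : rel {i : I & T i} :=
  fun a b => (tag a == tag b) && G (tag a) (tagged a) (tagged_as a b).

(* The join of a single vertex, [None], with the graph [e]. *)
Definition cone (T : finType) (e : rel T) : rel (option T) :=
  fun a b => match a, b with
             | Some a', Some b' => e a' b'
             | None, None => false
             | _, _ => true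
             end.

Definition multi_fan_vertex (r : nat) (p : 'I_r -> nat) : finType :=
  option {i : 'I_r & 'I_(p i)}.

Definition multi_fan (r : nat) (p : 'I_r -> nat) : rel (multi_fan_vertex p) :=
  cone (disjoint_union (fun i => path_graph (s := p i))).

Arguments multi_fan {r} p _ _.

Lemma multi_fan_sym (r : nat) (p : 'I_r -> nat) : ssrbool.symmetric (multi_fan p).
Proof.
case=> [[i a]|] [[j b]|] //=; rewrite /disjoint_union /= [j == i]eq_sym.
case: eqP => //= eij; case: _ / eij b => b.
by rewrite !tagged_asE /path_graph orbC.
Qed.

Lemma multi_fan_irr (r : nat) (p : 'I_r -> nat) : irreflexive (multi_fan p).
Proof.
case=> [[i a]|] //=; rewrite /disjoint_union /= eqxx /= tagged_asE /path_graph.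
by rewrite orbb gtn_eqF.
Qed.

(** The indeterminates x_v and y_v are the variables of
    index [enum_rank v] in the first and in the second block of #|V| variables;
    [le] is the total order on the vertices. *)

Section BinomialEdgeIdeal.
Variables (K : fieldType) (V : finType).

Definition bei_ring := {mpoly K[#|V| + #|V|]}.
Definition xvar (v : V) : bei_ring := 'X_(lshift #|V| (enum_rank v)).
Definition yvar (v : V) : bei_ring := 'X_(rshift #|V| (enum_rank v)).

Variables (le e : rel V).

Definition in_bei (f : bei_ring) : Prop :=
  exists c : V -> V -> bei_ring,
    f = \sum_i \sum_(j | [&& e i j, i != j & le i j])
          c i j * (xvar i * yvar j - xvar j * yvar i).

Definition bei : {pred bei_ring} := fun f => boolp.asbool (in_bei f).

Lemma bei_idealr_closed : idealr_closed bei.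
Proof.
split.
- apply/boolp.asboolP; exists (fun _ _ => 0).
  by rewrite big1 // => i _; rewrite big1 // => j _; rewrite mul0r.
- apply/negP => /boolp.asboolP [c] /(congr1 (meval (fun=> 0))) /eqP.
  rewrite rmorph1 raddf_sum big1 ?oner_eq0 // => i _.
  rewrite raddf_sum big1 // => j _.
  by rewrite /= mevalM mevalB !mevalM !mevalXU !mul0r subr0 mulr0.
- move=> a f g /boolp.asboolP [c ->] /boolp.asboolP [d ->].
  apply/boolp.asboolP; exists (fun i j => a * c i j + d i j).
  rewrite mulr_sumr -big_split; apply: eq_bigr => i _ /=.
  rewrite mulr_sumr -big_split; apply: eq_bigr => j _ /=.
  by rewrite mulrDl mulrA.
Qed.

HB.instance Definition _ := isIdealr.Build bei_ring bei bei_idealr_closed.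

End BinomialEdgeIdeal.

Arguments bei K {V} le e _.

(** [prime_idealr R] is the type of proper prime ideals of R, as boolean
    predicates; classically these are all the prime ideals. *)

Definition prime_chain (R : comNzRingType) (d : nat) : Prop :=
  exists P : 'I_d.+1 -> prime_idealr R,
    forall i j : 'I_d.+1, (i < j)%N ->
      {subset P i <= P j} /\ ~ {subset P j <= P i}.

Definition has_krull_dim (R : comNzRingType) (d : nat) : Prop :=
  prime_chain R d /\ forall m, prime_chain R m -> (m <= d)%N.

Definition series := nat -> int.

Definition series_mul (a b : series) : series :=
  fun k => \sum_(i < k.+1) a i * b (k - i)%N.

Definition series_of_poly (Q : {poly int}) : series := fun k => Q`_k.

(* The expansion of Q / (1 - t)^d: multiply Q, d times, by 1 / (1 - t), the
   series all of whose coefficients are 1. *)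
Definition series_frac (Q : {poly int}) (d : nat) : series :=
  iter d (series_mul (fun=> 1)) (series_of_poly Q).

Lemma series_mul_geom (a : series) :
  series_mul (series_of_poly (1 - 'X)) (series_mul (fun=> 1) a) =1 a.
Proof.
have geomE k : series_mul (fun=> 1) a k = \sum_(i < k.+1) a i.
  rewrite /series_mul (reindex_inj rev_ord_inj) /=.
  by apply: eq_bigr => i _; rewrite mul1r subSS subKn // -ltnS.
case=> [|k].
  rewrite {1}/series_mul big_ord1 geomE big_ord1 /series_of_poly.
  by rewrite coefB coef1 coefX subr0 mul1r.
rewrite {1}/series_mul 2!big_ord_recl big1 => [|i _]; last first.
  by rewrite /series_of_poly coefB coef1 coefX /= subr0 mul0r.
rewrite /series_of_poly !coefB !coef1 !coefX /= subr0 sub0r mul1r mulN1r addr0.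
rewrite /bump /= subn0 subn1 /= !geomE [in X in X + _]big_ord_recr /=.
by rewrite addrAC subrr add0r.
Qed.

Lemma series_fracK (Q : {poly int}) (d : nat) :
  iter d (series_mul (series_of_poly (1 - 'X))) (series_frac Q d)
    =1 series_of_poly Q.
Proof.
have ext m (u v : series) : u =1 v ->
    iter m (series_mul (series_of_poly (1 - 'X))) u
      =1 iter m (series_mul (series_of_poly (1 - 'X))) v.
  move=> uv; elim: m => [//|m IHm] k.
  by apply: eq_bigr => i _; congr (_ * _); exact: IHm.
elim: d => [//|d IHd] k; rewrite iterSr -[RHS]IHd.
by apply: ext; exact: series_mul_geom.
Qed.

(** J is meant to be homogeneous, so that S/J, for S = K[X_0, ..., X_(n-1)],
    is standard graded. *)

Section Hilbert.
Variables (K : fieldType) (n : nat) (J : idealr {mpoly K[n]}).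
Local Notation SJ := {ideal_quot J}.

(* The component (S/J)_k. *)
Definition in_component (k : nat) (x : SJ) : Prop :=
  exists2 f : {mpoly K[n]}, f \is k.-homog & x = \pi_SJ f.

(* dim_K (S/J)_k = d: the component has a K-basis with d elements. *)
Definition component_dim (k d : nat) : Prop :=
  exists b : 'I_d -> SJ,
    (forall i, in_component k (b i)) /\
    (forall x, in_component k x ->
       exists! c : {ffun 'I_d -> K}, x = \sum_i \pi_SJ (c i)%:MP * b i).

Definition is_hilbert_series (H : series) : Prop :=
  forall k, exists2 d : nat, component_dim k d & H k = d%:Z.

Definition is_multiplicity (m : int) : Prop :=
  exists (d : nat) (Q : {poly int}),
    [/\ has_krull_dim SJ d, is_hilbert_series (series_frac Q d) & m = Q.[1]].

End Hilbert.

(* Main.v *)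
(** Each generator of J_G is a difference of two monomials, so dim (S/J_G)_k is
    the number of classes of monomials of degree k under the moves
    x_i y_j -> x_j y_i along edges {i,j}.  The class of a monomial is given by its
    total degree at each vertex and by its y-degree on each connected component
    of the graph induced on the vertices where it lives.  If the cone vertex v
    occurs there is a single component, and the classes of degree k are counted
    by k+1 choices of the y-degree times the number of degree vectors.  If v does
    not occur, each class has exactly one monomial divisible by no x_u y_w with
    u, w consecutive on a path; such a normal form is read along the paths, each
    edge contributing (1+t)/(1-t) and each new path 1/(1-t)^2.

    For the upper bound on the dimension, elements f_i in P_(i+1) \ P_i of a chain
    P_0 < ... < P_m have monomials linearly independent modulo P_0, whence
    N^m <= sum of the Hilbert function up to O(N), which is O(N^d).  A chain of
    length p+r is obtained from x_u -> a_u, y_u -> a_u t_i (u in the i-th path),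
    v -> 0, by killing first the t_i and then the a_u one at a time. *)

Require Import Defs.
From HB Require Import structures.
From mathcomp Require Import all_boot all_order all_algebra.
From mathcomp Require Import mpoly.
From mathcomp Require boolp.
From mathcomp Require Import zify ring.

Set Implicit Arguments.
Unset Strict Implicit.
Unset Printing Implicit Defensive.

Import GRing.Theory.
Local Open Scope ring_scope.
Local Open Scope quotient_scope.

(** * Prime chains and growth *)

Fixpoint exponents (N m : nat) : finType :=
  if m is m'.+1 then ('I_N * exponents N m')%type else unit.

Lemma card_exponents N m : #|exponents N m| = (N ^ m)%N.
Proof.
elim: m => [|m IHm] /=; first by rewrite card_unit.
by rewrite card_prod card_ord IHm expnS.
Qed.

Fixpoint monomial (R : comNzRingType) (f : nat -> R) (N m : nat) :
    exponents N m -> R :=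
  match m return exponents N m -> R with
  | 0 => fun=> 1
  | m'.+1 => fun t => f 0%N ^+ t.1 * monomial (fun i => f i.+1) t.2
  end.

Section PrimeChain.
Variables (K : fieldType) (R : comNzRingType) (iota : {rmorphism K -> R}).

(** Modulo [P1] only the term [g 0] survives, so [g 0] lies in [P1] and vanishes. As [P0] is prime
    and misses [f], the remaining sum can be divided by [f] and the argument repeated. *)
Lemma prime_step (P0 P1 : prime_idealr R) (f : R) (N : nat) (g : nat -> R) :
    {subset P0 <= P1} -> f \in P1 -> f \notin P0 ->
    (forall i : nat, g i \in P1 -> g i = 0) ->
  \sum_(i < N) f ^+ i * g i \in P0 -> forall i, (i < N)%N -> g i = 0.
Proof.
move=> sP01 fP1 fNP0; elim: N g => [//|N IHN] g gP1.
rewrite big_ord_recl expr0 mul1r.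
under eq_bigr do rewrite lift0 exprS -mulrA.
rewrite -mulr_sumr => sumP0.
have sumP1 : f * \sum_(i < N) f ^+ i * g i.+1 \in P1.
  by rewrite prime_idealrM fP1.
have g0 : g 0%N = 0.
  apply: gP1; rewrite -[g 0%N](addrK (f * \sum_(i < N) f ^+ i * g i.+1)).
  by rewrite rpredB // sP01.
move: sumP0; rewrite g0 add0r prime_idealrM (negPf fNP0) /= => sumP0.
case=> // i ltiN; apply: (IHN (fun i => g i.+1)) => // j; exact: gP1.
Qed.

(* A relation among the monomials in f_0, ..., f_(m-1) can be divided by f_0
   modulo P_0, and reducing it modulo P_1 then removes f_0. *)
Lemma prime_chain_indep (m N : nat) (P : nat -> prime_idealr R) (f : nat -> R)
    (c : exponents N m -> K) :
    (forall i, (i < m)%N -> {subset P i <= P i.+1}) ->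
    (forall i, (i < m)%N -> f i \in P i.+1) ->
    (forall i, (i < m)%N -> f i \notin P i) ->
  \sum_t iota (c t) * monomial f t \in P 0%N -> forall t, c t = 0.
Proof.
elim: m P f c => [|m IHm] P f c sP fP fNP.
  rewrite (bigD1 tt) //= big1 => [|[] //]; rewrite addr0 mulr1 => cP.
  case; apply/eqP; apply: contraLR cP => cn0.
  apply/negP => /(idealMr (iota (c tt)^-1)).
  by rewrite -rmorphM mulVf // rmorph1 idealr1.
pose F (i : 'I_N) (t : exponents N m) : R :=
  iota (c (i, t)) * (f 0%N ^+ i * monomial (fun i => f i.+1) t).
rewrite (_ : \sum_t _ = \sum_i \sum_t F i t) => [cP|]; last first.
  by rewrite pair_bigA; apply: eq_bigr => -[].
(* [prime_step] takes a family indexed by [nat], so the coefficients are extended by zero from index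
   [N] on. *)
pose cn (i : nat) (t : exponents N m) := if insub i is Some i' then c (i', t) else 0.
pose g (i : nat) : R := \sum_t iota (cn i t) * monomial (fun i => f i.+1) t.
have IH i : g i \in P 1%N -> forall t, cn i t = 0.
  apply: (IHm (fun i => P i.+1)) => j ltjm; [exact: sP|exact: fP|exact: fNP].
have gP i : g i \in P 1%N -> g i = 0.
  by move/IH => c0; rewrite /g big1 // => t _; rewrite c0 rmorph0 mul0r.
have sumP : \sum_(i < N) f 0%N ^+ i * g i \in P 0%N.
  congr (_ \in P 0%N): cP; apply: eq_bigr => i _; rewrite /g mulr_sumr.
  apply: eq_bigr => t _; rewrite /cn; case: insubP => [j _ /val_inj ->|].
    by rewrite mulrCA.
  by rewrite ltn_ord.
have g0 := prime_step (sP _ (ltn0Sn m)) (fP _ (ltn0Sn m)) (fNP _ (ltn0Sn m)) gP sumP.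
case=> i t; have /IH/(_ t) : g i \in P 1%N by rewrite g0 ?rpred0.
by rewrite /cn; case: insubP => [j _ /val_inj ->|]; rewrite ?ltn_ord.
Qed.

(** The coefficients are indexed by all of [nat], so that concatenating two lists only shifts an
    index. *)
Definition spanned (s : seq R) (x : R) : Prop :=
  exists c : nat -> K, x = \sum_(i < size s) iota (c i) * s`_i.

Lemma spanned_cat s1 s2 x1 x2 :
  spanned s1 x1 -> spanned s2 x2 -> spanned (s1 ++ s2) (x1 + x2).
Proof.
move=> [c1 ->] [c2 ->].
exists (fun i => if (i < size s1)%N then c1 i else c2 (i - size s1)%N).
rewrite size_cat big_split_ord; congr (_ + _); apply: eq_bigr => i _ /=.
  by rewrite ltn_ord nth_cat ltn_ord.
by rewrite nth_cat ltnNge leq_addr /= addKn.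
Qed.

(** A nonzero row in the left kernel of the matrix expressing the [g t] through [s] would be a
    relation among the [g t]. So the rows are independent, and they are at most as many as the
    columns. *)
Lemma spanned_card (s : seq R) (T : finType) (g : T -> R) :
    (forall t, spanned s (g t)) ->
    (forall c : T -> K, \sum_t iota (c t) * g t = 0 -> forall t, c t = 0) ->
  (#|T| <= size s)%N.
Proof.
move=> /boolp.choice [A gE] indep.
pose M : 'M[K]_(#|T|, size s) := \matrix_(i, j) A (enum_val i) j.
suff /eqP <- : row_free M by exact: rank_leq_col.
rewrite -kermx_eq0; apply/eqP/row_matrixP => i; rewrite row0.
set u := row i _; have uM : u *m M = 0 by rewrite -row_mul mulmx_ker row0.
have u0 : forall t, u 0 (enum_rank t) = 0.
  apply: indep; under eq_bigr => t _ do rewrite gE mulr_sumr.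
  rewrite exchange_big big1 // => j _ /=.
  under eq_bigr => t _ do rewrite mulrA -rmorphM.
  rewrite -mulr_suml -rmorph_sum (_ : \sum_t _ = (u *m M) 0 j).
    by rewrite uM mxE rmorph0 mul0r.
  rewrite [RHS]mxE (reindex (@enum_rank T)) /=; last first.
    by exists enum_val => ? _; rewrite ?enum_rankK ?enum_valK.
  by apply: eq_bigr => t _; rewrite [M _ _]mxE enum_rankK.
by apply/rowP => j; rewrite -[j]enum_valK u0 mxE.
Qed.

End PrimeChain.

Section Growth.
Variables (K : fieldType) (n : nat) (J : idealr {mpoly K[n]}).
Local Notation SJ := {ideal_quot J}.

Definition scalar_quot (c : K) : SJ := \pi_SJ c%:MP.

Lemma scalar_quot_additive : additive scalar_quot.
Proof. by move=> c d; rewrite /scalar_quot mpolyCB rmorphB. Qed.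

Lemma scalar_quot_multiplicative : multiplicative scalar_quot.
Proof.
by split=> [c d|]; rewrite /scalar_quot ?mpolyCM ?mpolyC1 ?(rmorphM, rmorph1).
Qed.

HB.instance Definition _ := GRing.isAdditive.Build K SJ scalar_quot
  scalar_quot_additive.
HB.instance Definition _ := GRing.isMultiplicative.Build K SJ scalar_quot
  scalar_quot_multiplicative.

(** Since [msize] is the degree plus one, this is the filtration by degree of some representative;
    every element of the quotient has a bound, and bounds add under products. *)
Definition has_degree_le (D : nat) (x : SJ) : Prop :=
  exists2 f : {mpoly K[n]}, (msize f <= D.+1)%N & x = \pi_SJ f.

Lemma has_degree_leW D D' x : (D <= D')%N -> has_degree_le D x -> has_degree_le D' x.
Proof. by move=> leD [f szf ->]; exists f => //; apply: leq_trans szf _. Qed.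

Lemma has_degree_le1 : has_degree_le 0 1.
Proof. by exists 1; rewrite ?msize1 ?rmorph1. Qed.

Lemma has_degree_leM D D' x y :
  has_degree_le D x -> has_degree_le D' y -> has_degree_le (D + D') (x * y).
Proof.
move=> [f szf ->] [g szg ->]; exists (f * g); last by rewrite rmorphM.
have [->|f0] := eqVneq f 0; first by rewrite mul0r msize0.
have [->|g0] := eqVneq g 0; first by rewrite mulr0 msize0.
rewrite msizeM //; have := leq_add szf szg.
by rewrite addSn addnS; case: (_ + _)%N.
Qed.

Lemma has_degree_leX D x k : has_degree_le D x -> has_degree_le (k * D) (x ^+ k).
Proof.
move=> xD; elim: k => [|k IHk]; first exact: has_degree_le1.
by rewrite exprS mulSn; apply: has_degree_leM.
Qed.

Lemma has_degree_le_ex x : exists D, has_degree_le D x.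
Proof. by exists (msize (repr x)); exists (repr x); rewrite ?reprK. Qed.

Lemma has_degree_le_monomial D N m (f : nat -> SJ) (t : exponents N m) :
    (forall i, (i < m)%N -> has_degree_le D (f i)) ->
  has_degree_le (m * (N * D)) (monomial f t).
Proof.
elim: m f t => [|m IHm] f t fD; first exact: has_degree_le1.
rewrite mulSn; apply: has_degree_leM.
  apply: has_degree_leW (has_degree_leX t.1 (fD _ (ltn0Sn m))).
  by rewrite leq_mul2r ltnW ?orbT.
by apply: IHm => i ltim; apply: fD.
Qed.

(** A representative is cut into its homogeneous parts of degree at most [D], and [s] concatenates
    bases of these components. *)
Lemma has_degree_le_spanned (H : series) (D : nat) :
    is_hilbert_series J H ->
  exists2 s : seq SJ, (size s)%:Z = \sum_(k < D.+1) H k &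
    forall x, has_degree_le D x -> spanned scalar_quot s x.
Proof.
move=> hilbH.
have comp_span k : exists2 s : seq SJ, (size s)%:Z = H k &
    forall x, in_component k x -> spanned scalar_quot s x.
  have [d [b [bk bP]] Hd] := hilbH k.
  exists [seq b i | i <- enum 'I_d]; first by rewrite size_map size_enum_ord.
  move=> x /bP[c [xE _]]; exists (fun i => if insub i is Some j then c j else 0).
  rewrite size_map xE -(big_mkord xpredT (fun i => scalar_quot
     (if insub i is Some j then c j else 0) * [seq b i | i <- enum 'I_d]`_i)).
  rewrite size_enum_ord big_mkord; apply: eq_bigr => i _.
  rewrite valK (nth_map i) ?size_enum_ord // nth_ord_enum //.
have comp_sum_span D' : exists2 s : seq SJ, (size s)%:Z = \sum_(k < D') H k &
    forall f : {mpoly K[n]}, spanned scalar_quot s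
       (\pi_SJ (\sum_(k < D') pihomog mdeg k f)).
  elim: D' => [|D' [s1 sz1 span1]].
    exists [::]; rewrite ?big_ord0 // => f.
    by exists (fun=> 0); rewrite !big_ord0 rmorph0.
  have [s2 sz2 span2] := comp_span D'; exists (s1 ++ s2).
    by rewrite size_cat PoszD big_ord_recr /= sz1 sz2.
  move=> f; rewrite big_ord_recr rmorphD; apply: spanned_cat; first exact: span1.
  by apply: span2; exists (pihomog mdeg D' f) => //; apply: pihomogP.
have [s szs span] := comp_sum_span D.+1; exists s => // x [f szf ->].
by rewrite (pihomog_partitionE szf); apply: span.
Qed.

(** Choose one element in each successive difference of the chain and let [D] bound their degrees.
    The N^m monomials in them with exponents below [N] are independent and have degree at most
    [m * (N * D)]. *)
Lemma prime_chain_growth (H : series) (m : nat) :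
    is_hilbert_series J H -> prime_chain SJ m ->
  exists D, forall N, (N ^ m)%:Z <= \sum_(k < (m * (N * D)).+1) H k.
Proof.
move=> hilbH [P chainP]; pose Q (i : nat) := P (inord i).
have chainQ i : (i < m)%N ->
    {subset Q i <= Q i.+1} /\ exists x, (x \in Q i.+1) && (x \notin Q i).
  move=> ltim; have [|sQ nsQ] := chainP (inord i) (inord i.+1).
    by rewrite !inordK // ltnS // ltnW.
  split=> //; apply: boolp.contrapT => noQ; apply: nsQ => x xQ.
  by apply: boolp.contrapT => /negP xNQ; apply: noQ; exists x; rewrite xQ.
have f_ex i : exists x, (i < m)%N -> (x \in Q i.+1) && (x \notin Q i).
  have [/chainQ[_ [x xP]]|_] := ltnP i m; first by exists x.
  by exists 0.
have [f fP] := boolp.choice f_ex.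
have [deg degP] := boolp.choice (fun i => has_degree_le_ex (f i)).
exists (\max_(i < m) deg i)%N => N; set D := (\max_(i < m) deg i)%N.
have [s <- span] := has_degree_le_spanned (m * (N * D)) hilbH.
rewrite lez_nat -card_exponents; 
apply: (@spanned_card K SJ scalar_quot s (exponents N m) (@monomial SJ f N m))
  => [t|c sum0].
  apply: span; apply: has_degree_le_monomial => i ltim.
  apply: has_degree_leW (degP i); exact: (leq_bigmax (Ordinal ltim)).
apply: (prime_chain_indep (iota := scalar_quot) (P := Q) (f := f)) => [i|i|i|].
- by case/chainQ.
- by case/fP/andP.
- by case/fP/andP.
by rewrite sum0 rpred0.
Qed.

End Growth.

(** * Coefficients of Q / (1 - t)^d and their growth *)

Lemma series_mul_geomE (a : series) k :
  series_mul (fun=> 1) a k = \sum_(i < k.+1) a i.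
Proof.
rewrite /series_mul (reindex_inj rev_ord_inj) /=.
by apply: eq_bigr => i _; rewrite mul1r subSS subKn // -ltnS.
Qed.

Lemma series_fracS Q d k :
  series_frac Q d.+1 k = \sum_(i < k.+1) series_frac Q d i.
Proof. exact: series_mul_geomE. Qed.

Lemma series_frac_sumr Q d k :
  series_frac Q d.+1 k.+1 = series_frac Q d.+1 k + series_frac Q d k.+1.
Proof. by rewrite !series_fracS big_ord_recr. Qed.

Lemma series_fracD Q1 Q2 d k :
  series_frac (Q1 + Q2) d k = series_frac Q1 d k + series_frac Q2 d k.
Proof.
elim: d k => [|d IHd] k; first exact: coefD.
by rewrite !series_fracS -big_split; apply: eq_bigr => i _.
Qed.

Lemma series_fracN Q d k : series_frac (- Q) d k = - series_frac Q d k.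
Proof.
elim: d k => [|d IHd] k; first exact: coefN.
by rewrite !series_fracS -sumrN; apply: eq_bigr => i _.
Qed.

Lemma series_fracC c Q d k : series_frac (c%:P * Q) d k = c * series_frac Q d k.
Proof.
elim: d k => [|d IHd] k; first exact: coefCM.
by rewrite !series_fracS mulr_sumr; apply: eq_bigr => i _.
Qed.

Lemma series_fracX0 Q d : series_frac (Q * 'X) d 0 = 0.
Proof.
elim: d => [|d IHd]; first exact: coefMX.
by rewrite series_fracS big_ord1.
Qed.

Lemma series_fracXS Q d k : series_frac (Q * 'X) d k.+1 = series_frac Q d k.
Proof.
elim: d k => [|d IHd] k; first exact: coefMX.
rewrite !series_fracS big_ord_recl series_fracX0 add0r.
by apply: eq_bigr => i _; rewrite lift0.
Qed.

Lemma series_frac_1subX Q d k :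
  series_frac (Q * (1 - 'X)) d.+1 k = series_frac Q d k.
Proof.
rewrite mulrBr mulr1 series_fracD series_fracN; case: k => [|k].
  by rewrite series_fracX0 subr0 series_fracS big_ord1.
by rewrite series_fracXS series_frac_sumr addrC addKr.
Qed.

Lemma series_frac_1subXn Q d e k :
  series_frac (Q * (1 - 'X) ^+ e) (d + e) k = series_frac Q d k.
Proof.
elim: e k => [|e IHe] k; first by rewrite mulr1 addn0.
by rewrite exprSr mulrA addnS series_frac_1subX.
Qed.

Lemma series_frac1 d k : series_frac 1 d.+1 k = 'C(k + d, d)%:Z.
Proof.
elim: d k => [|d IHd] k.
  rewrite series_fracS big_ord_recl /series_frac /= /series_of_poly coef1 /=.
  by rewrite big1 ?addr0 ?bin0 // => i _; rewrite coef1.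
elim: k => [|k IHk]; first by rewrite series_fracS big_ord1 IHd !add0n !binn.
rewrite series_frac_sumr IHk IHd -PoszD; congr Posz.
by rewrite !addSn !addnS binS.
Qed.

Lemma leq_expn2 (a b d : nat) : (a <= b)%N -> (a ^ d <= b ^ d)%N.
Proof. by case: d => [//|d] leab; rewrite leq_exp2r. Qed.

Lemma series_frac_bound Q d :
  exists C : nat, forall k, series_frac Q d.+1 k <= (C * k.+1 ^ d)%:Z.
Proof.
(* The sum of the absolute values of the coefficients of [Q] bounds all their partial sums; each
   further summation costs a factor k + 1. *)
exists (\sum_(i < size Q) `|(Q`_i)%R|)%N.
elim: d => [|d IHd] k; last first.
  rewrite series_fracS; apply: (@Order.POrderTheory.le_trans _ _
    (\sum_(i < k.+1) ((\sum_(i < size Q) `|(Q`_i)%R|) * k.+1 ^ d)%N%:Z)).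
    apply: Num.Theory.ler_sum => i _; apply: Order.POrderTheory.le_trans (IHd i) _.
    by rewrite lez_nat leq_mul2l leq_expn2 ?orbT.
  rewrite sumr_const card_ord -mulr_natr natz -PoszM -mulnA.
  by rewrite [(k.+1 ^ d * _)%N]mulnC expnS.
rewrite expn0 muln1 series_fracS.
have Qle i : Q`_i <= (`|(Q`_i)%R|%N)%:Z by lia.
have sum_le n : \sum_(i < n) Q`_i <= (\sum_(i < n) `|(Q`_i)%R|)%N%:Z.
  elim: n => [|n IHn]; first by rewrite !big_ord0.
  by rewrite !big_ord_recr /= PoszD; apply: Num.Theory.lerD.
apply: Order.POrderTheory.le_trans (sum_le _) _; rewrite lez_nat.
rewrite -!(big_mkord xpredT (fun i => `|(Q`_i)%R|%N)).
case: (leqP k.+1 (size Q)) => [lekQ|/ltnW leQk].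
  by rewrite [leqRHS](big_cat_nat (n := k.+1)) //= leq_addr.
have tail0 : (\sum_(size Q <= i < k.+1) `|(Q`_i)%R| = 0)%N.
  by rewrite big_nat_cond big1 // => i /andP[/andP[leQi _] _]; rewrite nth_default.
by rewrite (big_cat_nat (n := size Q)) //= tail0 addn0.
Qed.

Lemma leq_exp_growth (m d C a : nat) :
  (forall N, N ^ m <= C * (a * N).+1 ^ d)%N -> (m <= d)%N.
Proof.
move=> bound; rewrite leqNgt; apply/negP => ltdm.
(* At N = B + 1 the right side is at most B N^d, which is below N^(d+1), hence below N^m if d <
   m. *)
pose B := (C * a.+1 ^ d)%N.
have := bound B.+1; apply/negP; rewrite -ltnNge.
apply: (@leq_ltn_trans (B * B.+1 ^ d)).
  rewrite /B -mulnA -expnMn leq_mul2l leq_expn2 ?orbT //.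
  by rewrite mulSn addSn ltnS addnC leq_addr ?leq_addl // leq_addr.
rewrite -(subnK ltdm) addnS expnS expnD.
have := expn_gt0 B.+1 (m - d.+1); have := expn_gt0 B.+1 d; nia.
Qed.

Lemma hilbert_prime_chain_le (K : fieldType) (n : nat) (J : idealr {mpoly K[n]})
    (Q : {poly int}) (d m : nat) :
    is_hilbert_series J (series_frac Q d) -> prime_chain {ideal_quot J} m ->
  (m <= d)%N.
Proof.
move=> hilbQ /(prime_chain_growth hilbQ)[D growth].
have [C boundC] := series_frac_bound Q d.
apply: (@leq_exp_growth _ _ C (m * D)) => N; rewrite -lez_nat.
apply: Order.POrderTheory.le_trans (growth N) _.
by rewrite -series_fracS -mulnA [(D * N)%N]mulnC; apply: boundC.
Qed.

(** * A chain of primes *)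

Section QuotientKernel.
Variables (R : comNzRingType) (D : idomainType) (J : idealr R).
Variables (phi : {rmorphism R -> D}) (phiJ : forall f, f \in J -> phi f = 0).
Local Notation RJ := {ideal_quot J}.

(** Carrying the proof as an argument lets the ideal structures declared below refer to it. By
    [quot_kerE] the value does not depend on the chosen representative. *)
Definition quot_ker (_ : forall f, f \in J -> phi f = 0) : {pred RJ} :=
  fun x => phi (repr x) == 0.

Lemma quot_kerE f : (\pi_RJ f \in quot_ker phiJ) = (phi f == 0).
Proof.
rewrite unfold_in; suff -> : phi (repr (\pi_RJ f)) = phi f by [].
apply/eqP; rewrite -subr_eq0 -rmorphB phiJ //.
by rewrite Quotient.idealrBE reprK.
Qed.

Lemma quot_ker_idealr_closed : idealr_closed (quot_ker phiJ).
Proof.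
split.
- by rewrite -(rmorph0 (\pi_RJ)) quot_kerE rmorph0.
- by rewrite -(rmorph1 (\pi_RJ)) quot_kerE rmorph1 oner_eq0.
move=> a u v; rewrite -[a]reprK -[u]reprK -[v]reprK -rmorphM -rmorphD !quot_kerE.
by rewrite rmorphD rmorphM => /eqP-> /eqP->; rewrite mulr0 addr0.
Qed.

Lemma quot_ker_prime_idealr_closed : prime_idealr_closed (quot_ker phiJ).
Proof.
move=> u v; rewrite -[u]reprK -[v]reprK -rmorphM !quot_kerE.
by rewrite rmorphM mulf_eq0.
Qed.

HB.instance Definition _ :=
  isIdealr.Build RJ (quot_ker phiJ) quot_ker_idealr_closed.
HB.instance Definition _ :=
  isPrimeIdealrClosed.Build RJ (quot_ker phiJ) quot_ker_prime_idealr_closed.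

Definition quot_ker_prime : prime_idealr RJ := quot_ker phiJ.

End QuotientKernel.

(** Kernels of morphisms into a domain are prime, and those containing [J] descend to the quotient.
    An element killed at stage i + 1 but not at stage i makes the inclusion strict. *)
Lemma prime_chain_kernels (R : comNzRingType) (D : idomainType) (J : idealr R)
    (d : nat) (phi : nat -> {rmorphism R -> D}) :
    (forall i f, f \in J -> phi i f = 0) ->
    (forall i f, phi i f = 0 -> phi i.+1 f = 0) ->
    (forall i, (i < d)%N -> exists2 f, phi i.+1 f = 0 & phi i f != 0) ->
  prime_chain {ideal_quot J} d.
Proof.
move=> phiJ phiS phiN; exists (fun i => quot_ker_prime (phiJ i)).
have phi_le i j f : (i <= j)%N -> phi i f = 0 -> phi j f = 0.
  move=> leij phi0; rewrite -(subnK leij); elim: (j - i)%N => [//|k IHk].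
  exact: phiS.
move=> i j ltij; split=> [x|sji].
  rewrite -[x]reprK !quot_kerE => /eqP phi0.
  by apply/eqP; apply: phi_le phi0; apply: ltnW.
have [|f phi0 /negP[]] := phiN i; first by apply: leq_trans ltij _; rewrite -ltnS.
by rewrite -(quot_kerE (phiJ i)); apply: sji; rewrite quot_kerE (phi_le _ _ _ ltij).
Qed.

Lemma rmorph_mmap (n : nat) (R S : comNzRingType) (T : comNzRingType)
    (f : {rmorphism R -> S}) (h : 'I_n -> S) (g : {rmorphism S -> T}) p :
  g (mmap f h p) = mmap (g \o f) (g \o h) p.
Proof.
rewrite /mmap raddf_sum; apply: eq_bigr => m _.
rewrite /= rmorphM rmorph_prod; congr (_ * _).
by apply: eq_bigr => i _; rewrite rmorphXn.
Qed.

Section Edges.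
Variables (K : fieldType) (V : finType) (le e : rel V) (S : comNzRingType).

Lemma mmap_bei_eq0 (f : {rmorphism K -> S}) (h : 'I_(#|V| + #|V|) -> S) :
    (forall i j, e i j ->
       h (lshift _ (enum_rank i)) * h (rshift _ (enum_rank j))
       = h (lshift _ (enum_rank j)) * h (rshift _ (enum_rank i))) ->
  forall q, q \in bei K le e -> mmap f h q = 0.
Proof.
move=> he q /boolp.asboolP[c ->]; rewrite raddf_sum big1 // => i _.
rewrite raddf_sum big1 // => j /andP[/he eij _] /=.
rewrite rmorphM rmorphB !rmorphM /= !mmapX !mmap1U eij.
by rewrite subrr mulr0.
Qed.

End Edges.

Section MultiFanChain.
Variables (K : fieldType) (r : nat) (p : 'I_r -> nat).
Hypothesis p_ge1 : forall i, (1 <= p i)%N.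
Variable le : rel (multi_fan_vertex p).
Local Notation U := {i : 'I_r & 'I_(p i)}.
Local Notation V := (multi_fan_vertex p).
Local Notation n := (r + #|{: U}|)%N.

Definition live_var (j : nat) (k : 'I_n) : {mpoly K[n]} :=
  if (j <= k)%N then 'X_k else 0.

(* x_u and y_u are sent to a_u and a_u t_i, where i is the path of u, and the
   first j of the variables t_1, ..., t_r, a_u, ... are then set to 0. *)
Definition param (j : nat) (k : 'I_(#|V| + #|V|)) : {mpoly K[n]} :=
  match split k with
  | inl k => if enum_val k is Some u then live_var j (rshift r (enum_rank u)) else 0
  | inr k => if enum_val k is Some u then
      live_var j (rshift r (enum_rank u)) * live_var j (lshift _ (tag u)) else 0
  end.

Lemma param_x j (v : V) : param j (lshift _ (enum_rank v)) =
  if v is Some u then live_var j (rshift r (enum_rank u)) else 0.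
Proof. by rewrite /param (unsplitK (inl _)) enum_rankK. Qed.

Lemma param_y j (v : V) : param j (rshift _ (enum_rank v)) =
  if v is Some u then
    live_var j (rshift r (enum_rank u)) * live_var j (lshift _ (tag u)) else 0.
Proof. by rewrite /param (unsplitK (inr _)) enum_rankK. Qed.

Definition param_morph j : {rmorphism {mpoly K[#|V| + #|V|]} -> {mpoly K[n]}} :=
  mmap (@mpolyC n K) (param j).

Lemma param_morph_bei j q : q \in bei K le (multi_fan p) -> param_morph j q = 0.
Proof.
apply: mmap_bei_eq0 => -[u|] [w|] //; rewrite !(param_x, param_y) ?mul0r ?mulr0 //.
by case/andP=> /eqP tag_uw _; rewrite tag_uw; ring.
Qed.

(** Setting the variable of index [j] to zero, which is the morphism [psi], carries stage [j] of the
    parametrization to stage [j.+1]. *)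
Lemma param_morphS j q : param_morph j q = 0 -> param_morph j.+1 q = 0.
Proof.
pose kill (k : 'I_n) : {mpoly K[n]} := if k == j :> nat then 0 else 'X_k.
pose psi : {rmorphism {mpoly K[n]} -> {mpoly K[n]}} := mmap (@mpolyC n K) kill.
have psi_live k : psi (live_var j k) = live_var j.+1 k.
  rewrite /live_var; case: ltngtP => [ltjk|ltkj|eqjk].
  - by rewrite /psi /= mmapX mmap1U /kill gtn_eqF.
  - by rewrite rmorph0.
  by rewrite /psi /= mmapX mmap1U /kill eqjk eqxx.
move=> q0; rewrite -(rmorph0 psi) -{}q0 /param_morph /= rmorph_mmap.
rewrite /mmap; apply: eq_bigr => m _ /=; congr (_ * _).
  by rewrite /psi /= mmapC.
apply: mmap1_eq => k /=; rewrite /param.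
case: (split k) => {}k; case: (enum_val k) => [u|]; rewrite ?rmorph0 //.
  by rewrite -psi_live.
by rewrite -!psi_live -rmorphM.
Qed.

Lemma multi_fan_prime_chain :
  prime_chain {ideal_quot (bei K le (multi_fan p) : idealr _)} (r + \sum_(i < r) p i).
Proof.
have -> : (r + \sum_(i < r) p i)%N = n.
  rewrite card_tagged sumnE big_map big_enum; congr (_ + _)%N.
  by apply: eq_bigr => i _; rewrite card_ord.
apply: (prime_chain_kernels (phi := param_morph)) param_morph_bei param_morphS _.
move=> i ltin; pose k := Ordinal ltin.
have [ltir|leri] := ltnP i r.
  (* While i < r, the variable killed next is t_i. For u the first vertex of the i-th path, y_u is
     sent to a_u t_i, and a_u is still alive. *)
  pose u : U := Tagged (fun i => 'I_(p i)) (Ordinal (p_ge1 (Ordinal ltir))).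
  exists (yvar K (Some u : V)); rewrite /param_morph /= /yvar mmapX mmap1U param_y.
    by rewrite /live_var /= ltnn mulr0.
  rewrite /live_var /= leqnn ltnW ?mulf_neq0 // -?msize_poly_eq0 ?msizeX //.
  by apply: leq_trans ltir (leq_addr _ _).
(* Once all t_i are gone, index i belongs to a_u for the vertex u of rank i - r, and x_u detects
   it. *)
have ltiU : (i - r < #|{: U}|)%N by rewrite ltn_subLR.
pose u : U := enum_val (Ordinal ltiU).
exists (xvar K (Some u : V)); rewrite /param_morph /= /xvar mmapX mmap1U param_x.
  by rewrite /live_var /u enum_valK /= subnKC // ltnn.
by rewrite /live_var /u enum_valK /= subnKC // leqnn -msize_poly_eq0 msizeX.
Qed.

End MultiFanChain.

(** * Monomials modulo a binomial edge ideal *)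

Section MonomialClasses.
Variables (V : finType) (e : rel V).
Local Notation n := (#|V| + #|V|)%N.
Local Notation mon := 'X_{1..n}.

Definition xpos (v : V) : 'I_n := lshift #|V| (enum_rank v).
Definition ypos (v : V) : 'I_n := rshift #|V| (enum_rank v).

Definition vdeg (m : mon) (v : V) : nat := (m (xpos v) + m (ypos v))%N.

Definition live_edge (m : mon) : rel V :=
  fun u w => [&& e u w, (0 < vdeg m u)%N & (0 < vdeg m w)%N].

(* Two monomials agree modulo the binomial edge ideal iff they have the same
   image under [mclass]: the degree at each vertex, and the y-degree on each
   component of the graph induced on the vertices that occur in m. *)
Definition mclass (m : mon) : {ffun V -> nat} * {ffun V -> nat} :=
  ([ffun v => vdeg m v],
   [ffun v => \sum_(w | connect (live_edge m) v w) m (ypos w)]%N).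

Lemma eq_pos : ((forall u v, (xpos u == xpos v) = (u == v)) *
  (forall u v, (ypos u == ypos v) = (u == v)) *
  (forall u v, (xpos u == ypos v) = false) *
  (forall u v, (ypos u == xpos v) = false))%type.
Proof.
split; first split; first split.
- by move=> u v; rewrite (inj_eq (@lshift_inj _ _)) (inj_eq enum_rank_inj).
- by move=> u v; rewrite (inj_eq (@rshift_inj _ _)) (inj_eq enum_rank_inj).
- by move=> u v; rewrite eq_lrshift.
- by move=> u v; rewrite eq_rlshift.
Qed.

Lemma pos_ind (P : 'I_n -> Prop) :
  (forall v, P (xpos v)) -> (forall v, P (ypos v)) -> forall i, P i.
Proof.
move=> Px Py i; rewrite -[i]splitK; case: (split i) => k /=.
  by rewrite -[k]enum_valK; apply: Px.
by rewrite -[k]enum_valK; apply: Py.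
Qed.

Lemma mon_eqP (m1 m2 : mon) : (forall v, vdeg m1 v = vdeg m2 v) ->
  (forall v, m1 (ypos v) = m2 (ypos v)) -> m1 = m2.
Proof.
move=> eqd eqy; apply/mnmP; apply: pos_ind => v //.
by have := eqd v; rewrite /vdeg eqy => /addIn.
Qed.

Lemma mdeg_vdeg (m : mon) : mdeg m = (\sum_v vdeg m v)%N.
Proof.
rewrite mdegE big_split_ord big_split /=; congr (_ + _)%N.
  rewrite (reindex (@enum_rank V)) //.
  by exists enum_val => ? _; rewrite ?enum_rankK ?enum_valK.
rewrite (reindex (@enum_rank V)) //.
by exists enum_val => ? _; rewrite ?enum_rankK ?enum_valK.
Qed.

Lemma vdegE (m : mon) u w v :
  vdeg (m + U_(xpos u) + U_(ypos w)) v = (vdeg m v + (u == v) + (w == v))%N.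
Proof. by rewrite /vdeg !mnmDE !mnm1E !eq_pos; lia. Qed.

Lemma eq_live_edge (m1 m2 : mon) :
  vdeg m1 =1 vdeg m2 -> live_edge m1 =2 live_edge m2.
Proof. by move=> eqd u w; rewrite /live_edge !eqd. Qed.

(** The swap moves one y from [w] to [u] inside a single component; vertex degrees, and with them
    the live graph, stay the same. *)
Lemma mclass_swap (m : mon) u w (m1 := (m + U_(xpos u) + U_(ypos w))%MM) :
    connect_sym (live_edge m1) -> connect (live_edge m1) u w ->
  mclass m1 = mclass (m + U_(xpos w) + U_(ypos u)).
Proof.
move=> csym uw; have eqd : vdeg m1 =1 vdeg (m + U_(xpos w) + U_(ypos u)).
  by move=> v; rewrite !vdegE; lia.
congr (_, _); apply/ffunP => v; rewrite !ffunE; first exact: eqd.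
rewrite -(eq_bigl _ _ (eq_connect (eq_live_edge eqd) v)).
have eqC : connect (live_edge m1) v u = connect (live_edge m1) v w.
  by rewrite [LHS]csym [RHS]csym; apply: same_connect.
transitivity (\sum_(z | connect (live_edge m1) v z) (m (ypos z) + (w == z)))%N.
  by apply: eq_bigr => z _; rewrite !mnmDE !mnm1E !eq_pos addn0.
transitivity (\sum_(z | connect (live_edge m1) v z) (m (ypos z) + (u == z)))%N.
  rewrite !big_split; congr (_ + _)%N.
  have ind t : (\sum_(z | connect (live_edge m1) v z) (t == z) =
      connect (live_edge m1) v t)%N.
    rewrite big_mkcond (bigD1 t) //= eqxx big1 ?addn0 => [|z]; first by case: ifP.
    by rewrite eq_sym => /negPf->; case: ifP.
  by rewrite !ind eqC.
by apply: eq_bigr => z _; rewrite !mnmDE !mnm1E !eq_pos addn0.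
Qed.

Hypothesis e_sym : ssrbool.symmetric e.

Lemma live_edge_csym (m : mon) : connect_sym (live_edge m).
Proof.
by apply: sym_connect_sym => u w; rewrite /live_edge e_sym andbCA -andbC andbA.
Qed.

Variables (K : fieldType) (le : rel V).
Hypothesis le_total : total le.
Local Notation J := (bei K le e).
Local Notation x := (xvar K).
Local Notation y := (yvar K).

Lemma bei_edge u w : e u w -> x u * y w - x w * y u \in J.
Proof.
wlog leuw : u w / le u w => [bei_le euw|euw].
  have /orP[/bei_le->//|lewu] := le_total u w.
  by rewrite -opprB rpredN bei_le // e_sym.
have [->|neq_uw] := eqVneq u w; first by rewrite subrr rpred0.
apply/boolp.asboolP; exists (fun i j => if (i == u) && (j == w) then 1 else 0).
rewrite (bigD1 u) //= (bigD1 w) /=; last by rewrite euw neq_uw.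
rewrite !eqxx mul1r big1 => [|j /andP[_ /negPf->]]; last by rewrite andbF mul0r.
rewrite addr0 big1 ?addr0 // => i /negPf neq_iu.
by rewrite big1 // => j _; rewrite neq_iu mul0r.
Qed.

(* x_v (x_u y_w - x_w y_u) = x_u (x_v y_w - x_w y_v) + x_w (x_u y_v - x_v y_u),
   and likewise for y_v. *)
Lemma bei_path (m : mon) u s w : path e u (rcons s w) -> uniq s ->
  (forall v, v \in s -> 0 < vdeg m v)%N -> 'X_[m] * (x u * y w - x w * y u) \in J.
Proof.
elim: s m u => [|v s IHs] m u /=.
  by rewrite andbT => euw _ _; apply/idealMr/bei_edge.
move=> /andP[euv path_s] /andP[vNs uniq_s] pos_s.
have posv : (0 < m (xpos v) + m (ypos v))%N by apply: (pos_s v); rewrite mem_head.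
(* As [v] is not in [s], removing one variable at [v] from [m] keeps the degrees along [s] that the
   induction hypothesis needs. *)
have IHm m' z : (forall v', v' \in s -> vdeg m' v' = vdeg m v') ->
    'X_[m'] * z * (x v * y w - x w * y v) \in J.
  move=> eqm; rewrite mulrAC mulrC idealMr // IHs // => v' v's.
  by rewrite eqm // pos_s // in_cons v's orbT.
have Juv z : z * (x u * y v - x v * y u) \in J by apply/idealMr/bei_edge.
have vNv' v' : v' \in s -> (v == v') = false.
  by move=> v's; apply: contraNF vNs => /eqP->.
have [m0x|mx] := posnP (m (xpos v)).
  have leU : (U_(ypos v) <= m)%MM by rewrite lep1mP -lt0n; rewrite m0x in posv.
  rewrite -(submK leU) mpolyXD; set m' := (m - _)%MM.
  rewrite (_ : _ * _ = 'X_[m'] * y u * (x v * y w - x w * y v) +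
                       'X_[m'] * y w * (x u * y v - x v * y u)).
    apply: rpredD => //; apply: IHm => v' /vNv' neq.
    by rewrite /vdeg !mnmBE !mnm1E !eq_pos neq !subn0.
  by rewrite -[in X in X * _ = _]/(y v); ring.
have leU : (U_(xpos v) <= m)%MM by rewrite lep1mP -lt0n.
rewrite -(submK leU) mpolyXD; set m' := (m - _)%MM.
rewrite (_ : _ * _ = 'X_[m'] * x u * (x v * y w - x w * y v) +
                     'X_[m'] * x w * (x u * y v - x v * y u)).
  apply: rpredD => //; apply: IHm => v' /vNv' neq.
  by rewrite /vdeg !mnmBE !mnm1E !eq_pos neq !subn0.
by rewrite -[in X in X * _ = _]/(x v); ring.
Qed.

(** A connecting walk can be shortened to a simple path. Its inner vertices then avoid [u] and [w],
    so they occur already in [m], and [bei_path] applies. *)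
Lemma connect_bei (m : mon) u w (m1 := (m + U_(xpos w) + U_(ypos u))%MM) :
    u != w -> connect (live_edge m1) u w ->
  'X_[m1] - 'X_[m + U_(xpos u) + U_(ypos w)] \in J.
Proof.
move=> neq_uw /connectP[s0 path_s0 w_last].
case: (shortenP path_s0) w_last => {s0 path_s0} s path_s uniq_s _ w_last.
case/lastP: s path_s uniq_s w_last => [|s w'].
  by move=> _ _ w_u; rewrite w_u eqxx in neq_uw.
rewrite last_rcons => path_s uniq_s eq_w; rewrite -{w'}eq_w in path_s uniq_s.
move: uniq_s; rewrite /= mem_rcons rcons_uniq in_cons negb_or -andbA.
case/and4P=> _ uNs wNs uniq_s.
have path_e : path e u (rcons s w).
  by apply: sub_path path_s => v v' /and3P[].
have pos_s v : v \in s -> (0 < vdeg m v)%N.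
  move=> vs; have : (0 < vdeg m1 v)%N.
    have /(nthP u)[i ltis vE] : v \in rcons s w by rewrite mem_rcons in_cons vs orbT.
    by have /(pathP u)/(_ i ltis)/and3P[_ _] := path_s; rewrite vE.
  rewrite vdegE; have [uv|_] := eqVneq u v; first by rewrite uv vs in uNs.
  by have [wv|_] := eqVneq w v; [rewrite wv vs in wNs|rewrite !addn0].
rewrite /m1 !mpolyXD -!mulrA -mulrBr -opprB mulrN rpredN.
by rewrite [X in _ * (_ - X)](_ : _ = x w * y u) //; apply: bei_path path_e _ _.
Qed.

Lemma mclass_vdeg (m1 m2 : mon) : mclass m1 = mclass m2 -> vdeg m1 =1 vdeg m2.
Proof. by case=> /ffunP eqd _ v; have := eqd v; rewrite !ffunE. Qed.

Lemma mclass_sum (m1 m2 : mon) : mclass m1 = mclass m2 ->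
  forall v, (\sum_(w | connect (live_edge m1) v w) m1 (ypos w) =
    \sum_(w | connect (live_edge m1) v w) m2 (ypos w))%N.
Proof.
move=> eqc v; have [_ /ffunP/(_ v)] := eqc; rewrite !ffunE => ->.
by apply: eq_bigl => w; apply/esym/eq_connect/eq_live_edge/mclass_vdeg.
Qed.

Lemma sum_eq_ltn (C : pred V) (f g : V -> nat) v : C v ->
    (\sum_(w | C w) f w = \sum_(w | C w) g w)%N -> f v != g v ->
  exists2 u, C u & (f u < g u)%N.
Proof.
move=> Cv eqs /eqP neq_v; apply: boolp.contrapT => no_u; apply: neq_v.
have le_gf u : C u -> (g u <= f u)%N.
  by move=> Cu; rewrite leqNgt; apply/negP => ltu; apply: no_u; exists u.
have [_] := leqif_sum (fun u Cu => leqif_eq (le_gf u Cu)).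
by rewrite eqs eqxx => /esym/forall_inP/(_ v Cv)/eqP.
Qed.

(** Induction on the total excess of the y-exponents of [m1] over those of [m2]. In a component
    where they differ, some u has too many y and some w too few. As the degrees agree, x_w divides
    [m1], and replacing x_w y_u by x_u y_w lowers the excess without leaving the class. *)
Lemma mclass_bei (m1 m2 : mon) :
  mclass m1 = mclass m2 -> 'X_[m1] - 'X_[m2] \in J.
Proof.
have [N] := ubnP (\sum_v (m1 (ypos v) - m2 (ypos v))).
elim: N m1 => // N IHN m1 leN eqc.
have eqd := mclass_vdeg eqc.
have [/forallP eqy|] := boolP [forall v, m1 (ypos v) == m2 (ypos v)].
  rewrite (mon_eqP (m1 := m1) (m2 := m2)) ?subrr ?rpred0 // => v.
  exact/eqP.
rewrite negb_forall => /existsP[v neq_v].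
have [w vw ltw] := sum_eq_ltn (connect0 _ v) (mclass_sum eqc v) neq_v.
rewrite eq_sym in neq_v.
have [u vu ltu] := sum_eq_ltn (connect0 _ v) (esym (mclass_sum eqc v)) neq_v.
have uw : connect (live_edge m1) u w.
  by apply: connect_trans vw; rewrite live_edge_csym.
have neq_uw : u != w by apply: contraL ltu => /eqP->; rewrite -leqNgt ltnW.
have xw : (0 < m1 (xpos w))%N by have := eqd w; rewrite /vdeg; lia.
have lex : (U_(xpos w) <= m1)%MM by rewrite lep1mP -lt0n.
have ley : (U_(ypos u) <= m1 - U_(xpos w))%MM.
  by rewrite lep1mP mnmBE mnm1E eq_pos subn0 -lt0n; lia.
set m0 := (m1 - U_(xpos w) - U_(ypos u))%MM.
have m1E : m1 = (m0 + U_(xpos w) + U_(ypos u))%MM.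
  by rewrite -addmA [(U_(xpos w) + _)%MM]addmC addmA !submK.
pose m3 := (m0 + U_(xpos u) + U_(ypos w))%MM.
have J13 : 'X_[m1] - 'X_[m3] \in J by rewrite m1E connect_bei // -m1E.
have c13 : mclass m1 = mclass m3.
  by rewrite m1E mclass_swap //; [exact: live_edge_csym|rewrite -m1E live_edge_csym].
rewrite -[_ - _](subrKA 'X_[m3]) rpredD // IHN -?c13 //.
rewrite -ltnS; apply: leq_trans leN; rewrite ltnS.
have m3y z : m3 (ypos z) = (m1 (ypos z) - (u == z) + (w == z))%N.
  by rewrite m1E !mnmDE !mnm1E !eq_pos; lia.
rewrite (bigD1 u) //= [ltnRHS](bigD1 u) //= -addSn leq_add //.
  rewrite m3y eqxx [w == u]eq_sym (negPf neq_uw) /= addn0 subn1.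
  by case: (m1 (ypos u)) ltu => // k; rewrite ltnS => leuk; rewrite subSn.
apply: leq_sum => z /negPf; rewrite eq_sym => neq_uz; rewrite m3y neq_uz.
have [<-|_] := eqVneq w z; last by rewrite addn0 subn0.
by rewrite subn0 addn1; move: ltw; rewrite -!subn_eq0 => /eqP->.
Qed.

(** These linear functionals separate the classes modulo the ideal; the bound [B] on the degree
    keeps the sum finite. *)
Definition class_coef (B : nat) (c : {ffun V -> nat} * {ffun V -> nat})
  (f : {mpoly K[n]}) : K := \sum_(m : 'X_{1..n < B} | mclass m == c) f@_m.

Lemma class_coef_linear B c : scalar (class_coef B c).
Proof.
move=> a f g; rewrite /class_coef mulr_sumr -big_split.
by apply: eq_bigr => m _; rewrite mcoeffD mcoeffZ.
Qed.

HB.instance Definition _ B c :=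
  GRing.isLinear.Build K {mpoly K[n]} K _ (class_coef B c)
    (class_coef_linear B c).

Lemma class_coefX B c (m : mon) :
  class_coef B c 'X_[m] = ((mdeg m < B)%N && (mclass m == c))%:R.
Proof.
rewrite /class_coef; under eq_bigr do rewrite mcoeffX.
have [ltm|leB] := ltnP (mdeg m) B; last first.
  rewrite big1 // => m' _; case: eqP => // eq_m.
  by have := bmdeg m'; rewrite -eq_m ltnNge leB.
rewrite big_mkcond (bigD1 (BMultinom ltm)) //= eqxx big1 ?addr0 => [|m' neq_m].
  by case: ifP.
rewrite (_ : m == m' = false); first by case: ifP.
by apply: contraNF neq_m => /eqP eq_m; rewrite bmeqP /= eq_m.
Qed.

(** A monomial multiple of a generator is a difference of two monomials of the same class and
    degree, so its two contributions cancel. *)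
Lemma class_coef_bei B c f : f \in J -> class_coef B c f = 0.
Proof.
move=> /boolp.asboolP[d ->]; rewrite raddf_sum big1 // => i _.
rewrite raddf_sum big1 // => j /andP[eij _] /=.
rewrite [d i j]mpolyE mulr_suml raddf_sum big1 // => m _.
rewrite -scalerAl /= linearZ /= mulrBr raddfB /= !mulrA -!mpolyXD !class_coefX.
have swap : mclass (m + U_(xpos i) + U_(ypos j)) = mclass (m + U_(xpos j) + U_(ypos i)).
  apply: mclass_swap; first exact: live_edge_csym.
  by apply: connect1; rewrite /live_edge eij !vdegE !eqxx /=; lia.
by rewrite swap !mdegD !mdeg1 subrr mulr0.
Qed.

Local Notation SJ := {ideal_quot (J : idealr _)}.

Lemma bei_component_dim k (L : seq mon) :
    (forall m, m \in L -> mdeg m = k) -> uniq [seq mclass m | m <- L] ->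
    (forall m, mdeg m = k -> mclass m \in [seq mclass m | m <- L]) ->
  component_dim (J : idealr _) k (size L).
Proof.
move=> degL uniqL coverL; pose mL (i : 'I_(size L)) := tnth (in_tuple L) i.
have mL_in i : mL i \in L by apply: mem_tnth.
have mL_inj i j : (mclass (mL i) == mclass (mL j)) = (i == j).
  apply/eqP/eqP => [|->//]; rewrite /mL !(tnth_nth 0%MM) /= => eqc.
  apply: val_inj; apply/eqP; rewrite -(nth_uniq (mclass 0%MM) _ _ uniqL) ?size_map;
    [|exact: ltn_ord..].
  by rewrite !(nth_map (0%MM : mon)); [apply/eqP|exact: ltn_ord..].
have sumE (c : {ffun 'I_(size L) -> K}) :
    \sum_i \pi_SJ (c i)%:MP * \pi_SJ 'X_[mL i] =
    \pi_SJ (\sum_i c i *: 'X_[mL i]).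
  by rewrite rmorph_sum; apply: eq_bigr => i _; rewrite -rmorphM mul_mpolyC.
exists (fun i => \pi_SJ 'X_[mL i]); split.
  by move=> i; exists 'X_[mL i] => //; rewrite dhomogX; apply/eqP/degL.
move=> _ [f f_homog ->].
(* Monomials of one class agree modulo [J], so the coefficients of [f] are collected on the
   representative of each class. *)
pose c : {ffun 'I_(size L) -> K} :=
  [ffun i => \sum_(m <- msupp f | mclass (mL i) == mclass m) f@_m].
have piE : \pi_SJ f = \pi_SJ (\sum_i c i *: 'X_[mL i]).
  apply/eqP; rewrite -Quotient.idealrBE {1}[f]mpolyE.
  under [X in _ - X]eq_bigr => i _ do rewrite ffunE scaler_suml.
  rewrite (exchange_big_dep xpredT) //= -sumrB big_seq rpred_sum // => m mf.
  have /mapP[m' m'L eqc] : mclass m \in [seq mclass m | m <- L].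
    by apply: coverL; exact: (dhomog_mf f_homog).
  have [i iE] : exists i, m' = mL i.
    by have /tnthP[i ->] : m' \in in_tuple L by []; exists i.
  rewrite eqc iE (big_pred1 i) => [|j]; last exact: mL_inj.
  by rewrite -scalerBr -mul_mpolyC idealMr // mclass_bei // eqc iE.
exists c; split=> [|c']; rewrite sumE //.
move/eqP; rewrite piE -Quotient.idealrBE -sumrB => sum_J.
apply/ffunP => j; apply/eqP; rewrite -subr_eq0; apply/eqP.
(* The functional of the j-th class picks out the j-th coefficient; the bound [k.+1] admits degree
   [k]. *)
rewrite -(class_coef_bei k.+1 (mclass (mL j)) sum_J) raddf_sum (bigD1 j) //=.
have coefX i : class_coef k.+1 (mclass (mL j)) 'X_[mL i] = (i == j)%:R.
  by rewrite class_coefX degL // ltnSn mL_inj.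
rewrite raddfB /= !linearZ /= coefX eqxx !mulr1 big1 ?addr0 // => i /negPf neq_ij.
by rewrite raddfB /= !linearZ /= coefX neq_ij !mulr0 subrr.
Qed.

End MonomialClasses.

(** * Cones over disjoint paths *)

Section NormalForms.
Variables (V : eqType) (e : rel V).

Definition adj_head (u : V) (s : seq V) : bool :=
  if s is w :: _ then e u w else false.

Fixpoint adj_count (s : seq V) : nat :=
  if s is u :: s' then (adj_head u s' + adj_count s')%N else 0.

(* The exponents (a, b) of x_u and y_u, for u in s, in the monomials of degree k
   divisible by no x_u y_w with u, w consecutive in s and adjacent; z tells that
   y_u must not occur for the first u. *)
Fixpoint nforms (z : bool) (s : seq V) (k : nat) : seq (seq (nat * nat)) :=
  if s is u :: s' then
    [seq t | b <- iota 0 (if z then 1 else k.+1)%N,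
             t <- [seq (a, b) :: t | a <- iota 0 (k - b).+1,
                     t <- nforms ((0 < a)%N && adj_head u s') s' (k - b - a)]]
  else if k is 0 then [:: [::]] else [::].

Lemma nforms_cons z u s k : nforms z (u :: s) k =
  [seq t | b <- iota 0 (if z then 1 else k.+1)%N,
           t <- [seq (a, b) :: t | a <- iota 0 (k - b).+1,
                   t <- nforms ((0 < a)%N && adj_head u s) s (k - b - a)]].
Proof. by []. Qed.

Lemma nforms_true u s k : nforms true (u :: s) k =
  [seq (a, 0%N) :: t | a <- iota 0 k.+1,
           t <- nforms ((0 < a)%N && adj_head u s) s (k - a)].
Proof. by rewrite nforms_cons [iota 0 _]/= allpairs1l map_id subn0. Qed.

Lemma mem_nforms z s k (x y : V -> nat) :
  ([seq (x u, y u) | u <- s] \in nforms z s k) =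
  [&& z ==> (if s is u :: _ then y u == 0 else true)%N,
      (\sum_(u <- s) (x u + y u) == k)%N
    & sorted (fun u w => ~~ [&& e u w, 0 < x u & 0 < y w])%N s].
Proof.
elim: s z k => [|u s IHs] z k.
  by rewrite big_nil implybT andbT; case: k.
rewrite big_cons nforms_cons [map _ _]/= [sorted _ _]/=.
have -> : path (fun u w => ~~ [&& e u w, 0 < x u & 0 < y w])%N u s =
    (((0 < x u)%N && adj_head u s) ==> (if s is u :: _ then y u == 0 else true)%N)
    && sorted (fun u w => ~~ [&& e u w, 0 < x u & 0 < y w])%N s.
  case: (s) => [|w s'] /=; first by rewrite implybT.
  by congr (_ && _); rewrite eqn0Ngt; case: (e u w); case: (0 < x u)%N => //=;
    case: (0 < y w)%N.
apply/allpairsPdep/and3P => [[b [t [b_in t_in t_def]]]|[yz sum_k /andP[nf_head nf_s]]].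
  move: t_in; rewrite -{t}t_def => /allpairsPdep[a [t [a_in t_in [xE yE tE]]]].
  subst a b t; move: b_in a_in t_in; rewrite !mem_iota !add0n IHs /=.
  move=> b_in a_in /and3P[nf_head /eqP sum_s nf_s].
  split; last by rewrite nf_head nf_s.
    by case: z b_in => //=; rewrite ltnS leqn0.
  rewrite sum_s; apply/eqP; move: b_in a_in; case: z; lia.
exists (y u), [seq (x u, y u) | u <- u :: s]; split=> //.
  by rewrite mem_iota add0n /=; case: z yz => //=; lia.
apply/allpairsPdep; exists (x u), [seq (x u, y u) | u <- s]; split=> //.
  by rewrite mem_iota add0n; lia.
rewrite IHs nf_head nf_s andbT /=; lia.
Qed.

Lemma size_nforms_seq z s k t : t \in nforms z s k -> size t = size s.
Proof.
elim: s z k t => [|u s IHs] z k t; first by case: k => // /[!inE]/eqP->.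
rewrite nforms_cons => /allpairsPdep[b [t1 [_ t1_in ->]]].
by move: t1_in => /allpairsPdep[a [t2 [_ /IHs t2_in ->]]] /=; rewrite t2_in.
Qed.

Lemma uniq_nforms z s k : uniq (nforms z s k).
Proof.
elim: s z k => [|u s IHs] z k; first by case: k.
rewrite nforms_cons; apply: allpairs_uniq_dep => [|b _|]; first exact: iota_uniq.
  apply: allpairs_uniq_dep => [|a _|]; [exact: iota_uniq|exact: IHs|].
  by move=> [a1 t1] [a2 t2] _ _ /= [-> ->].
move=> _ _ /allpairsPdep[b1 [t1 [_ t1_in ->]]] /allpairsPdep[b2 [t2 [_ t2_in ->]]] /=.
move: t1_in t2_in => /allpairsPdep[? [? [_ _ ->]]] /allpairsPdep[? [? [_ _ ->]]].
by move=> [-> -> ->].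
Qed.

Lemma size_nforms_true u s k : (size (nforms true (u :: s) k) =
  \sum_(a < k.+1) size (nforms ((0 < k - a) && adj_head u s) s a))%N.
Proof.
rewrite nforms_true size_allpairs_dep sumnE big_map.
rewrite -[iota 0 _]/(index_iota 0 k.+1) big_mkord (reindex_inj rev_ord_inj) /=.
by apply: eq_bigr => a _; rewrite subSS subKn // -ltnS.
Qed.

Lemma size_nforms_false u s k : (size (nforms false (u :: s) k) =
  \sum_(b < k.+1) size (nforms true (u :: s) b))%N.
Proof.
rewrite nforms_cons size_allpairs_dep sumnE big_map.
rewrite -[iota 0 _]/(index_iota 0 k.+1) big_mkord (reindex_inj rev_ord_inj).
apply: eq_bigr => b _; rewrite nforms_true !size_allpairs_dep.
by have -> : (k - rev_ord b = b)%N by rewrite /= subSS subKn // -ltnS.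
Qed.

Lemma sum_Posz k (f : 'I_k -> nat) :
  (\sum_(a < k) f a)%N%:Z = \sum_(a < k) (f a)%:Z.
Proof. exact: (big_morph Posz PoszD). Qed.

Lemma adj_count_le s : (adj_count s <= size s)%N.
Proof.
by elim: s => //= u s IHs; case: adj_head; rewrite ?add1n ?add0n // leqW.
Qed.

(** A free exponent of y_u gives a factor 1/(1-t). The exponent of x_u gives another one if u is not
    adjacent to the next vertex. Otherwise exponent 0 leaves the tail free, while the positive
    exponents forbid the next y and together count t times the free tail, so the factor is 1 + t. *)
Lemma series_nforms s k : (size (nforms false s k))%:Z =
  series_frac ((1 + 'X) ^+ adj_count s) (2 * size s - adj_count s) k.
Proof.
elim: s k => [|u s IHs] k.
  by case: k => [|k]; rewrite expr0 /series_frac /= /series_of_poly coef1.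
set d := (2 * size s - adj_count s)%N in IHs.
suff trueE j : (size (nforms true (u :: s) j))%:Z =
    series_frac ((1 + 'X) ^+ adj_count (u :: s)) (d + ~~ adj_head u s) j.
  have -> : (2 * size (u :: s) - adj_count (u :: s) = (d + ~~ adj_head u s).+1)%N.
    by rewrite /d /=; have := adj_count_le s; case: adj_head => /=; lia.
  rewrite size_nforms_false sum_Posz series_fracS.
  by apply: eq_bigr => j _; rewrite trueE.
rewrite size_nforms_true /=; case: (boolP (adj_head u s)) => adj_us; last first.
  rewrite addn1 add0n series_fracS sum_Posz.
  by apply: eq_bigr => a _; rewrite andbF IHs.
rewrite addn0 add1n exprS mulrDl mul1r series_fracD big_ord_recr /= subnn PoszD IHs.
rewrite addrC; congr (_ + _); rewrite mulrC; case: j => [|j].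
  by rewrite big_ord0 series_fracX0.
rewrite series_fracXS -IHs; case: (s) adj_us => // w s' _.
rewrite size_nforms_false; congr Posz; apply: eq_bigr => a _.
by rewrite subn_gt0 ltn_ord.
Qed.

End NormalForms.

Lemma connect_ind (V : finType) (g : rel V) (Q : V -> Prop) a b :
  Q a -> (forall c d, Q c -> g c d -> Q d) -> connect g a b -> Q b.
Proof.
move=> Qa Qg /connectP[s]; elim: s a Qa => [|c s IHs] a Qa /=; first by move=> _ ->.
by case/andP=> /(Qg _ _ Qa) Qc; apply: IHs.
Qed.

Section MonomialOf.
Variable V : finType.
Local Notation mon := 'X_{1..#|V| + #|V|}.

Definition monomial_of (x y : V -> nat) : mon :=
  [multinom match split i with
            | inl k => x (enum_val k)
            | inr k => y (enum_val k)
            end | i < _].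

Lemma monomial_of_x x y v : monomial_of x y (xpos v) = x v.
Proof. by rewrite mnmE (unsplitK (inl _)) enum_rankK. Qed.

Lemma monomial_of_y x y v : monomial_of x y (ypos v) = y v.
Proof. by rewrite mnmE (unsplitK (inr _)) enum_rankK. Qed.

Lemma monomial_of_vdeg x y v : vdeg (monomial_of x y) v = (x v + y v)%N.
Proof. by rewrite /vdeg monomial_of_x monomial_of_y. Qed.

(** Start with all degrees in the x-variables and turn one x_u into y_u at a time. *)
Lemma exists_monomial (alpha : V -> nat) i : (i <= \sum_v alpha v)%N ->
  exists m : mon, vdeg m =1 alpha /\ (\sum_v m (ypos v))%N = i.
Proof.
elim: i => [_|i IHi lti].
  exists (monomial_of alpha (fun=> 0%N)); split=> [v|].
    by rewrite monomial_of_vdeg addn0.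
  by rewrite big1 // => v _; rewrite monomial_of_y.
have [m [md ms]] := IHi (ltnW lti).
have [u xu] : exists u, (0 < m (xpos u))%N.
  apply/existsP; apply: contraLR lti; rewrite negb_exists => /forallP x0.
  rewrite -leqNgt -ms leq_sum // => v _; rewrite -md /vdeg.
  by have := x0 v; rewrite -eqn0Ngt => /eqP->.
exists (m - U_(xpos u) + U_(ypos u))%MM; split=> [v|].
  rewrite -md /vdeg !mnmDE !mnmBE !mnm1E !eq_pos.
  have [<-|_] := eqVneq u v; last by rewrite !subn0 !addn0.
  by rewrite subn0 addn0 subn1 addn1 -addSnnS prednK.
have -> : (\sum_v (m - U_(xpos u) + U_(ypos u))%MM (ypos v) =
    \sum_v (m (ypos v) + (u == v)))%N.
  by apply: eq_bigr => v _; rewrite mnmDE mnmBE !mnm1E !eq_pos subn0.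
rewrite big_split ms (bigD1 u) //= eqxx big1 ?addn0 ?addn1 // => v.
by rewrite eq_sym => /negPf->.
Qed.

End MonomialOf.

Section Cone.
Variables (T : finType) (e : rel T).
Hypothesis e_sym : ssrbool.symmetric e.
Local Notation V := (option T : finType).
Local Notation mon := 'X_{1..#|V| + #|V|}.

Lemma cone_sym : ssrbool.symmetric (cone e).
Proof. by move=> [u|] [w|] //=. Qed.

(** The cone vertex is adjacent to all others, so once it occurs the occurring vertices form one
    component; a vertex that does not occur is isolated and has y-exponent 0. *)
Lemma cone_component_sum (m : mon) v : (0 < vdeg m None)%N ->
  (\sum_(w | connect (live_edge (cone e) m) v w) m (ypos w) =
    if 0 < vdeg m v then \sum_w m (ypos w) else 0)%N.
Proof.
move=> liveN; have y_le w : (m (ypos w) <= vdeg m w)%N by rewrite leq_addl.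
have liveNw w : (0 < vdeg m w)%N -> connect (live_edge (cone e) m) None w.
  by case: w => [w|] // livew; apply: connect1; rewrite /live_edge liveN livew.
case: ifPn => [livev|]; last first.
  rewrite -eqn0Ngt => /eqP v0; apply: big1 => w vw.
  suff -> : w = v by apply/eqP; rewrite -leqn0 -v0.
  apply: (connect_ind (Q := fun w => w = v) _ _ vw) => // a b ->.
  by rewrite /live_edge v0 andbF.
rewrite [RHS](bigID (connect (live_edge (cone e) m) v)) /=.
rewrite -[LHS]addn0; congr (_ + _)%N; apply/esym/big1 => w Nvw.
apply/eqP; rewrite -leqn0; apply: leq_trans (y_le w) _; rewrite leqNgt.
apply: contra Nvw => /liveNw; apply: connect_trans.
by rewrite live_edge_csym ?liveNw //; apply: cone_sym.
Qed.

Lemma cone_mclass (m1 m2 : mon) : vdeg m1 =1 vdeg m2 -> (0 < vdeg m1 None)%N ->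
  mclass (cone e) m1 = mclass (cone e) m2 <->
  (\sum_v m1 (ypos v) = \sum_v m2 (ypos v))%N.
Proof.
move=> eqd live1; have live2 : (0 < vdeg m2 None)%N by rewrite -eqd.
split=> [[_ /ffunP/(_ None)]|eq_sum].
  by rewrite !ffunE !cone_component_sum // live1 live2.
congr (_, _); apply/ffunP => v; rewrite !ffunE // !cone_component_sum //.
by rewrite eqd eq_sum.
Qed.

End Cone.

Section ConeOverPaths.
Variables (T : finType) (e : rel T).
Hypothesis e_sym : ssrbool.symmetric e.
Variables (rho : T -> nat) (s : seq T).
Hypothesis s_sorted : sorted (fun u w => rho u < rho w)%N s.
Hypothesis mem_s : forall u, u \in s.
Hypothesis e_rho : forall u w, e u w -> rho w = (rho u).+1 \/ rho u = (rho w).+1.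
Local Notation V := (option T : finType).
Local Notation mon := 'X_{1..#|V| + #|V|}.
Local Notation X m u := (m (xpos (Some u : V))).
Local Notation Y m u := (m (ypos (Some u : V))).

Definition normal (m : mon) : Prop := forall u w : T,
  e u w -> (rho u < rho w)%N -> (0 < X m u)%N -> Y m w = 0%N.

Lemma rho_trans : transitive (fun u w : T => rho u < rho w)%N.
Proof. by move=> v u w; apply: ltn_trans. Qed.

Lemma uniq_s : uniq s.
Proof.
by apply: sorted_uniq s_sorted; [exact: rho_trans|move=> u; rewrite /= ltnn].
Qed.

Lemma rho_inj : injective rho.
Proof.
move=> u w eq_rho; apply: (@index_inj T u s _ _ (mem_s u) (mem_s w)).
have lt_index := sorted_ltn_index rho_trans s_sorted.
have [ltuw|ltwu|->//] := ltngtP (index u s) (index w s).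
- by have := lt_index _ _ (mem_s u) (mem_s w) ltuw; rewrite eq_rho ltnn.
by have := lt_index _ _ (mem_s w) (mem_s u) ltwu; rewrite eq_rho ltnn.
Qed.

(** [sorted] compares only neighbours in [s]. Adjacent vertices have consecutive ranks, so no entry
    of [s] can lie between them and they are neighbours there. *)
Lemma sorted_normal (m : mon) :
  sorted (fun u w => ~~ [&& e u w, 0 < X m u & 0 < Y m w])%N s <-> normal m.
Proof.
split=> [sorted_m u w euw ltuw xu|norm_m].
  have lt_index := sorted_ltn_index rho_trans s_sorted.
  have ltij : (index u s < index w s)%N.
    have [//|ltwu|eq_i] := ltngtP (index u s) (index w s).
      by have := lt_index _ _ (mem_s w) (mem_s u) ltwu; lia.
    have uw := @index_inj T u s _ _ (mem_s u) (mem_s w) eq_i.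
    by rewrite uw ltnn in ltuw.
  have ltjs : (index w s < size s)%N by rewrite index_mem.
  have indexS : (index u s).+1 = index w s.
    apply/eqP; rewrite eqn_leq ltij leqNgt; apply/negP => ltSij.
    have ltn_nth := sorted_ltn_nth rho_trans u s_sorted.
    have := ltn_nth (index u s) (index u s).+1; have := ltn_nth _ _ _ _ ltSij.
    rewrite !inE !nth_index // => /(_ (ltn_trans ltSij ltjs) ltjs) lt1.
    move=> /(_ (ltn_trans ltij ltjs) (ltn_trans ltSij ltjs) (ltnSn _)).
    by have [] := e_rho euw; lia.
  have /(sortedP u)/(_ (index u s)) := sorted_m; rewrite indexS !nth_index //.
  by move=> /(_ ltjs); rewrite euw xu /= -eqn0Ngt => /eqP.
case: (s) s_sorted => // u s' sorted_s'; apply/(sortedP u) => i lti.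
apply/negP => /and3P[ei xi]; rewrite (norm_m _ _ ei) //.
by have /(sortedP u) := sorted_s'; apply.
Qed.

Lemma vdeg0_xy (m : mon) v : vdeg m v = 0%N -> m (xpos v) = 0%N /\ m (ypos v) = 0%N.
Proof. by move/eqP; rewrite addn_eq0 => /andP[/eqP-> /eqP->]. Qed.

(** Normality propagates upwards from [u]: if x occurs at a vertex, y is absent at the next one,
    which occurs and hence has x again. *)
Lemma normal_connect (m : mon) u (w : V) : normal m -> vdeg m None = 0%N ->
    (0 < X m u)%N -> connect (live_edge (cone e) m) (Some u) w ->
  if w is Some z then (rho u < rho z)%N -> Y m z = 0%N else False.
Proof.
move=> norm_m m0 xu.
(* The invariant covers all ranks from [u] up to the current vertex, since the walk may turn back or
   pass below [u]. *)
pose Q (w : V) := if w is Some z then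
  forall z', (rho u < rho z' <= rho z)%N -> (0 < X m z')%N /\ Y m z' = 0%N
  else False.
move=> /(connect_ind (Q := Q)) Qw; suff : Q w.
  by case: (w) => [z|//] Qz ltz; apply: (Qz z _).2; rewrite ltz leqnn.
apply: Qw => [z|[a|//] [b|] Qa]; first by case: ltngtP.
  rewrite /live_edge /= => /and3P[eab _ liveb] z /andP[ltuz lezb].
  have [leza|ltaz] := leqP (rho z) (rho a); first by apply: Qa; rewrite ltuz.
  have eq_ba : rho b = (rho a).+1 by have [] := e_rho eab; lia.
  have -> : z = b by apply: rho_inj; lia.
  have xa : (0 < X m a)%N.
    have [leau|ltua] := leqP (rho a) (rho u); last first.
      by have [] := Qa a _; rewrite ?ltua ?leqnn.
    by have -> : a = u by apply: rho_inj; lia.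
  have yb : Y m b = 0%N by apply: norm_m eab _ xa; rewrite eq_ba.
  by split=> //; move: liveb; rewrite /vdeg yb addn0.
by rewrite /live_edge m0 !andbF.
Qed.

(* If y_u occurs less often in m1 than in m2 then x_u divides m1, so no y_z with z
   after u in the component of u divides m1, and the y-degrees there differ. *)
Lemma normal_le (m1 m2 : mon) u : normal m1 -> vdeg m1 None = 0%N ->
    mclass (cone e) m1 = mclass (cone e) m2 ->
    (forall z, (rho z < rho u)%N -> Y m1 z = Y m2 z) ->
  (Y m2 u <= Y m1 u)%N.
Proof.
move=> norm1 m10 eqc eq_lt; rewrite leqNgt; apply/negP => lt12.
have eqd := mclass_vdeg eqc.
have xu : (0 < X m1 u)%N.
  rewrite lt0n; apply: contraTneq lt12 => xu; rewrite -leqNgt.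
  by have := eqd (Some u); rewrite /vdeg xu add0n => ->; apply: leq_addl.
have := mclass_sum eqc (Some u); apply/eqP; rewrite ltn_eqF //.
rewrite (bigD1 (Some u)) ?connect0 //= [ltnRHS](bigD1 (Some u)) ?connect0 //=.
rewrite -addSn leq_add // leq_sum // => w /andP[uw neq_w].
have := normal_connect norm1 m10 xu uw; case: w uw neq_w => // z _ neq_z.
have [ltz _|ltz ->//|eq_z] := ltngtP (rho z) (rho u); first by rewrite eq_lt.
by rewrite (rho_inj eq_z) eqxx in neq_z.
Qed.

(** Induction on the rank: where all lower y-exponents agree, [normal_le] applies in both
    directions. The y-exponents and the degrees determine the monomial. *)
Lemma normal_mclass_inj (m1 m2 : mon) : normal m1 -> normal m2 ->
  vdeg m1 None = 0%N -> mclass (cone e) m1 = mclass (cone e) m2 -> m1 = m2.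
Proof.
move=> norm1 norm2 m10 eqc; have eqd := mclass_vdeg eqc.
have m20 : vdeg m2 None = 0%N by rewrite -eqd.
suff eqY N u : (rho u < N)%N -> Y m1 u = Y m2 u.
  apply: mon_eqP => // -[u|]; first exact: eqY (ltnSn _).
  by rewrite (vdeg0_xy m10).2 (vdeg0_xy m20).2.
elim: N u => // N IHN u; rewrite ltnS => leuN.
have eq_lt z : (rho z < rho u)%N -> Y m1 z = Y m2 z.
  by move=> ltz; apply: IHN; apply: leq_trans ltz leuN.
apply/eqP; rewrite eqn_leq !normal_le // => z /eq_lt //.
Qed.

(** Replacing x_u y_w by x_w y_u along an edge with [rho u < rho w] keeps the class and lowers the
    sum of the y-exponents weighted by rank. *)
Lemma exists_normal (m : mon) : vdeg m None = 0%N ->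
  exists2 m', normal m' & mclass (cone e) m' = mclass (cone e) m.
Proof.
move=> m0; have [N] := ubnP (\sum_u rho u * Y m u); elim: N m m0 => // N IHN m m0.
rewrite ltnS => leN; have [norm_m|not_norm] := boolp.EM (normal m); first by exists m.
have [u [w [euw ltuw xu yw]]] : exists u w,
    [/\ e u w, (rho u < rho w)%N, (0 < X m u)%N & (0 < Y m w)%N].
  apply: boolp.contrapT => no_uw; apply: not_norm => u w euw ltuw xu.
  by apply/eqP; rewrite eqn0Ngt; apply/negP => yw; apply: no_uw; exists u, w.
have lex : (U_(xpos (Some u : V)) <= m)%MM by rewrite lep1mP -lt0n.
have ley : (U_(ypos (Some w : V)) <= m - U_(xpos (Some u : V)))%MM.
  by rewrite lep1mP mnmBE mnm1E eq_pos subn0 -lt0n.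
set m1 := (m - U_(xpos (Some u : V)) - U_(ypos (Some w : V)))%MM.
have mE : m = (m1 + U_(xpos (Some u : V)) + U_(ypos (Some w : V)))%MM.
  by rewrite -addmA [(U_(xpos _) + _)%MM]addmC addmA !submK.
pose m2 := (m1 + U_(xpos (Some w : V)) + U_(ypos (Some u : V)))%MM.
have eqc : mclass (cone e) m = mclass (cone e) m2.
  rewrite mE mclass_swap //; first exact/live_edge_csym/cone_sym.
  by apply: connect1; rewrite /live_edge /= euw !vdegE !eqxx /=; lia.
rewrite eqc; apply: IHN; first by rewrite -(mclass_vdeg eqc).
apply: leq_trans leN.
pose pot (a : mon) := (\sum_u rho u * Y a u)%N.
have potE (a b : T) : pot (m1 + U_(xpos (Some a : V)) + U_(ypos (Some b : V)))%MM =
    (pot m1 + rho b)%N.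
  rewrite /pot (eq_bigr (fun z => rho z * Y m1 z + rho z * (b == z)))%N => [|z _].
    rewrite big_split; congr (_ + _)%N.
    rewrite (bigD1 b) //= eqxx muln1 big1 ?addn0 // => z.
    by rewrite eq_sym => /negPf->; rewrite muln0.
  by rewrite !mnmDE !mnm1E !eq_pos addn0 mulnDr.
by rewrite -/(pot m) -/(pot m2) mE !potE ltn_add2l.
Qed.

Lemma sum_option (f : V -> nat) :
  (\sum_v f v = f None + \sum_(u <- s) f (Some u))%N.
Proof.
rewrite -(perm_big _ (_ : perm_eq (None :: map Some s) _)) /=.
  by rewrite big_cons big_map.
apply: uniq_perm; rewrite ?index_enum_uniq //=.
  rewrite map_inj_uniq ?uniq_s ?andbT => [|? ? [->//]].
  by apply/mapP => -[].
by case=> [u|]; rewrite mem_index_enum in_cons //= map_f.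
Qed.

Definition seq_mon (t : seq (nat * nat)) : mon :=
  monomial_of
    (fun v : V => if v is Some u then (nth (0, 0)%N t (index u s)).1 else 0%N)
    (fun v : V => if v is Some u then (nth (0, 0)%N t (index u s)).2 else 0%N).

Lemma seq_monK t : size t = size s ->
  [seq (X (seq_mon t) u, Y (seq_mon t) u) | u <- s] = t.
Proof.
move=> sz_t; apply: (@eq_from_nth _ (0, 0)%N); rewrite size_map // => i lti.
have [u _] : exists2 u, u \in s & true.
  by case: (s) lti => // u; exists u; rewrite ?mem_head.
rewrite (nth_map u) // /seq_mon monomial_of_x monomial_of_y index_uniq ?uniq_s //.
by rewrite -surjective_pairing.
Qed.

Lemma seq_monE (m : mon) : vdeg m None = 0%N ->
  seq_mon [seq (X m u, Y m u) | u <- s] = m.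
Proof.
move=> /vdeg0_xy[x0 y0]; apply: mon_eqP => -[u|];
  rewrite ?monomial_of_vdeg ?monomial_of_y //.
- by rewrite (nth_map u) ?index_mem // nth_index.
- by rewrite /vdeg x0 y0.
by rewrite (nth_map u) ?index_mem // nth_index.
Qed.

Lemma seq_mon_vdeg0 t : vdeg (seq_mon t) None = 0%N.
Proof. by rewrite monomial_of_vdeg. Qed.

Lemma mem_nforms_mon (m : mon) k : vdeg m None = 0%N ->
  [seq (X m u, Y m u) | u <- s] \in nforms e false s k <-> mdeg m = k /\ normal m.
Proof.
move=> m0; rewrite (mem_nforms e false s k (fun u => X m u) (fun u => Y m u)) /=.
rewrite mdeg_vdeg sum_option m0 add0n.
by split=> [/andP[/eqP-> /sorted_normal]|[<- /sorted_normal->]]; rewrite ?eqxx.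
Qed.

Definition forest_mons k : seq mon := map seq_mon (nforms e false s k).

Lemma forest_monsP k (m : mon) : m \in forest_mons k ->
  [/\ vdeg m None = 0%N, mdeg m = k & normal m].
Proof.
move=> /mapP[t tk ->]; rewrite seq_mon_vdeg0.
have := tk; rewrite -{1}(seq_monK (size_nforms_seq tk)).
by case/(mem_nforms_mon _ (seq_mon_vdeg0 t)).
Qed.

Lemma forest_mons_uniq k : uniq (map (mclass (cone e)) (forest_mons k)).
Proof.
rewrite map_inj_in_uniq => [|m1 m2 /forest_monsP[m10 _ n1] /forest_monsP[_ _ n2]].
  rewrite map_inj_in_uniq ?uniq_nforms // => t1 t2.
  move=> /size_nforms_seq/seq_monK t1E /size_nforms_seq/seq_monK t2E eq_m.
  by rewrite -t1E -t2E eq_m.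
exact: normal_mclass_inj.
Qed.

Lemma forest_mons_cover k (m : mon) : vdeg m None = 0%N -> mdeg m = k ->
  mclass (cone e) m \in map (mclass (cone e)) (forest_mons k).
Proof.
move=> m0 mk; have [m' norm_m' eqc] := exists_normal m0.
have eqd := mclass_vdeg eqc; rewrite -eqc.
have m'0 : vdeg m' None = 0%N by rewrite eqd.
have m'k : mdeg m' = k by rewrite -mk !mdeg_vdeg; apply: eq_bigr => v _.
apply/map_f/mapP; exists [seq (X m' u, Y m' u) | u <- s]; last by rewrite seq_monE.
exact/mem_nforms_mon.
Qed.

(** Degree vectors that are positive at the cone vertex are coded by exponent vectors in [#|T|.+1]
    variables. The entry at [None] is stored minus one, so the total degree drops by one. *)
Definition cone_deg (M : 'X_{1..#|T|.+1}) (v : V) : nat :=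
  if v is Some u then M (lift ord0 (enum_rank u)) else (M ord0).+1.

Lemma sum_cone_deg M : (\sum_v cone_deg M v = (mdeg M).+1)%N.
Proof.
rewrite sum_option /= mdegE big_ord_recl addSn; congr (_ + _).+1.
rewrite (perm_big (index_enum T)) /=.
  rewrite [RHS](reindex (@enum_rank T)) //.
  by exists enum_val => ? _; rewrite ?enum_rankK ?enum_valK.
apply: uniq_perm; rewrite ?index_enum_uniq ?uniq_s // => u.
by rewrite mem_index_enum mem_s.
Qed.

Lemma cone_deg_inj M1 M2 : cone_deg M1 =1 cone_deg M2 -> M1 = M2.
Proof.
move=> eqM; apply/mnmP => i; have [->|[j ->]] : i = ord0 \/ exists j, i = lift ord0 j.
- by case: (unliftP ord0 i) => [j ->|->]; [right; exists j|left].
- by have [] := eqM None.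
by have := eqM (Some (enum_val j)); rewrite /= enum_valK.
Qed.

Lemma cone_degE (alpha : V -> nat) : (0 < alpha None)%N ->
  exists M, cone_deg M =1 alpha.
Proof.
move=> alpha0; exists [multinom if unlift ord0 i is Some j then
  alpha (Some (enum_val j)) else (alpha None).-1 | i < #|T|.+1].
by case=> [u|] /=; rewrite mnmE ?liftK ?enum_rankK // unlift_none prednK.
Qed.

Lemma exists_cone_mons : exists cone_mon : 'X_{1..#|T|.+1} * nat -> mon,
  forall a, (a.2 <= (mdeg a.1).+1)%N ->
    vdeg (cone_mon a) =1 cone_deg a.1 /\ (\sum_v cone_mon a (ypos v))%N = a.2.
Proof.
have ex_mon (a : 'X_{1..#|T|.+1} * nat) : exists m : mon, (a.2 <= (mdeg a.1).+1)%N ->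
    vdeg m =1 cone_deg a.1 /\ (\sum_v m (ypos v))%N = a.2.
  have [lei|_] := leqP a.2 (mdeg a.1).+1; last by exists 0%MM.
  have [|m m_def] := @exists_monomial V (cone_deg a.1) a.2.
    by rewrite sum_cone_deg.
  by exists m.
by have [f fP] := boolp.choice ex_mon; exists f.
Qed.

(** The tuples in [basis] encode the exponent vectors of degree [j], and the second entry is a
    y-degree from 0 to [k]. Degree 0 leaves no room for the cone vertex. *)
Definition cone_index k : seq ('X_{1..#|T|.+1} * nat) :=
  if k is j.+1 then
    [seq (M, i) | M <- [seq s2m t | t : j.-tuple 'I_#|T|.+1 <- enum (basis _ j)],
                  i <- iota 0 j.+2]
  else [::].

Lemma mem_cone_index k a : (a \in cone_index k) =
  ((mdeg a.1).+1 == k) && (a.2 <= k)%N.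
Proof.
case: k a => [|j] [M i] //; rewrite /cone_index eqSS basis_cover.
have -> : ((M, i).2 <= j.+1)%N = (i \in iota 0 j.+2) by rewrite mem_iota.
apply/allpairsP/andP => [[[M' i'] /= [M'_in i'_in [-> ->]]]|[M_in i_in]] //.
by exists (M, i).
Qed.

Lemma cone_index_uniq k : uniq (cone_index k).
Proof.
case: k => // j; apply: allpairs_uniq; [exact: uniq_basis|exact: iota_uniq|].
by move=> [M i] [M' i'] _ _ /= [-> ->].
Qed.

Lemma size_cone_index k :
  size (cone_index k) = (if k is j.+1 then 'C(j + #|T|, j) * j.+2 else 0)%N.
Proof. by case: k => // j; rewrite size_allpairs size_basis size_iota. Qed.

(** The forest normal forms represent the classes without the cone vertex, and the monomials
    [cone_mon a] those with it. The degree at [None] separates the two families. *)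
Lemma cone_component_dim (K : fieldType) (le : rel V) k : total le ->
  component_dim (bei K le (cone e) : idealr _) k
    (size (nforms e false s k) + size (cone_index k)).
Proof.
move=> le_total; have [cone_mon cone_monP] := exists_cone_mons.
have cone_mon_index a : a \in cone_index k ->
    vdeg (cone_mon a) =1 cone_deg a.1 /\ (\sum_v cone_mon a (ypos v))%N = a.2.
  by rewrite mem_cone_index => /andP[/eqP mk le_k]; apply: cone_monP; rewrite mk.
have cone_mon0 a : a \in cone_index k -> (0 < vdeg (cone_mon a) None)%N.
  by case/cone_mon_index => ->.
rewrite -(size_map seq_mon) -(size_map cone_mon) -size_cat.
apply: bei_component_dim => //; first exact: cone_sym.
- move=> m; rewrite mem_cat => /orP[/forest_monsP[_ ->]//|/mapP[a ak ->]].
  rewrite mdeg_vdeg; have [mdE _] := cone_mon_index _ ak.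
  under eq_bigr do rewrite mdE.
  by rewrite sum_cone_deg; move: ak; rewrite mem_cone_index => /andP[/eqP].
- rewrite map_cat cat_uniq forest_mons_uniq /=; apply/andP; split.
    apply/hasPn => _ /mapP[_ /mapP[a ak ->] ->].
    apply/negP => /mapP[m /forest_monsP[m0 _ _] eqc].
    by have := cone_mon0 _ ak; rewrite (mclass_vdeg eqc) m0.
  rewrite -map_comp map_inj_in_uniq ?cone_index_uniq // => a b ak bk /= eqc.
  have [da sa] := cone_mon_index _ ak; have [db sb] := cone_mon_index _ bk.
  have eqd := mclass_vdeg eqc.
  have [/(_ eqc) eq_sum _] := cone_mclass e_sym eqd (cone_mon0 _ ak).
  rewrite [a]surjective_pairing [b]surjective_pairing; congr (_, _).
    by apply: cone_deg_inj => v; rewrite -da -db eqd.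
  by rewrite -sa -sb eq_sum.
move=> m mk; rewrite map_cat mem_cat.
have [m0|m0] := posnP (vdeg m None); first by rewrite forest_mons_cover.
have [M dM] := cone_degE m0; pose a := (M, (\sum_v m (ypos v))%N).
have ak : a \in cone_index k.
  rewrite mem_cone_index /= -sum_cone_deg -mk mdeg_vdeg (eq_bigr _ (fun v _ => dM v)).
  by rewrite eqxx leq_sum // => v _; rewrite leq_addl.
apply/orP; right; have [da sa] := cone_mon_index _ ak.
suff -> : mclass (cone e) m = mclass (cone e) (cone_mon a) by do 2! apply: map_f.
by apply/cone_mclass => // v; rewrite da /= dM.
Qed.

End ConeOverPaths.

(** * The multi-fan as a cone over disjoint paths *)

Lemma adj_count_cat (V : eqType) (e : rel V) u s1 s2 : path e u s1 ->
    ~~ adj_head e (last u s1) s2 ->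
  adj_count e (u :: s1 ++ s2) = (size s1 + adj_count e s2)%N.
Proof.
elim: s1 u => [|w s1 IHs] u /=; first by move=> _ /negPf->.
by move=> /andP[-> path_s1] /(IHs _ path_s1) /= ->.
Qed.

Section MultiFanPaths.
Variables (r : nat) (p : 'I_r -> nat).
Local Notation U := {i : 'I_r & 'I_(p i)}.
Local Notation P := (\sum_(i < r) p i)%N.
Local Notation e := (disjoint_union (fun i : 'I_r => path_graph (s := p i))).

Definition path_block (i : 'I_r) : seq U :=
  [seq Tagged (fun i => 'I_(p i)) a | a <- enum 'I_(p i)].

Definition path_blocks (s : seq 'I_r) : seq U := flatten (map path_block s).

(** Lexicographic order as a single number: positions within a path stay below [P.+1]. *)
Definition vertex_rank (u : U) : nat := (tag u * P.+1 + tagged u)%N.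

Lemma mem_path_block i u : (u \in path_block i) = (tag u == i).
Proof.
apply/mapP/eqP => [[a _ ->]//|<-]; exists (tagged u); first by rewrite mem_enum.
by case: u.
Qed.

Lemma mem_path_blocks s u : (u \in path_blocks s) = (tag u \in s).
Proof.
apply/flatten_mapP/idP => [[i si]|us]; first by rewrite mem_path_block => /eqP->.
by exists (tag u); rewrite ?mem_path_block.
Qed.

Lemma tagged_lt_sum (u : U) : (tagged u < P.+1)%N.
Proof.
rewrite ltnW // ltnS (leq_trans (ltn_ord _)) //.
by rewrite (bigD1 (tag u)) //= leq_addr.
Qed.

Lemma path_blocks_sorted s : sorted (fun i j : 'I_r => i < j)%N s ->
  sorted (fun u w => vertex_rank u < vertex_rank w)%N (path_blocks s).
Proof.
have tr : transitive (fun u w => vertex_rank u < vertex_rank w)%N.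
  by move=> v u w; apply: ltn_trans.
rewrite !sorted_pairwise //; last by move=> j i k; apply: ltn_trans.
elim: s => //= i s IHs /andP[lt_is /IHs pair_s].
rewrite pairwise_cat pair_s andbT; apply/andP; split.
  apply/allrelP => u w; rewrite mem_path_block mem_path_blocks => /eqP eq_u.
  move=> /(allP lt_is); rewrite -eq_u /vertex_rank => ltuw.
  apply: (@leq_trans ((tag u).+1 * P.+1)); last first.
    by apply: leq_trans (leq_addr _ _); rewrite leq_mul2r ltuw orbT.
  by rewrite mulSn addnC ltn_add2r tagged_lt_sum.
rewrite pairwise_map -sorted_pairwise; last by move=> j i' k; apply: ltn_trans.
rewrite (eq_sorted (e' := relpre val ltn)) => [|a b] /=; last by rewrite ltn_add2l.
by rewrite -sorted_map val_enum_ord iota_ltn_sorted.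
Qed.

Lemma disjoint_paths_rank u w : e u w ->
  vertex_rank w = (vertex_rank u).+1 \/ vertex_rank u = (vertex_rank w).+1.
Proof.
case: u w => [i a] [j b] /andP[/= /eqP eij]; case: _ / eij b => b.
rewrite tagged_asE /vertex_rank /= -!addnS => /orP[/eqP->|/eqP->]; [by left|by right].
Qed.

Lemma disjoint_paths_sym : ssrbool.symmetric e.
Proof. by move=> u w; apply: (multi_fan_sym (p := p) (Some u) (Some w)). Qed.

Hypothesis p_ge1 : forall i, (1 <= p i)%N.

(** Each path contributes its own edges, and no adjacency arises where two blocks meet, because
    their tags differ. *)
Lemma adj_count_path_blocks s : uniq s ->
  adj_count e (path_blocks s) = (\sum_(i <- s) (p i).-1)%N.
Proof.
elim: s => [|i s IHs] /=; first by rewrite big_nil.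
move=> /andP[iNs /IHs adj_s]; rewrite big_cons -adj_s.
have size_i : size (path_block i) = p i by rewrite size_map size_enum_ord.
have sorted_i : sorted e (path_block i).
  rewrite sorted_map; apply: (sub_sorted (e := relpre val (fun a b => a.+1 == b))).
    by move=> a b /= ab; rewrite /disjoint_union /= eqxx tagged_asE /path_graph ab.
  rewrite -sorted_map val_enum_ord; apply/(sortedP 0%N) => j.
  rewrite size_iota => ltj; rewrite !nth_iota //; exact: ltnW.
rewrite /path_blocks /= -/(path_blocks s).
case blockE : (path_block i) size_i sorted_i => [|u b] /= size_i path_i.
  by have := p_ge1 i; rewrite -size_i.
rewrite -size_i; apply: adj_count_cat => //.
have tag_last : tag (last u b) = i.
  by apply/eqP; rewrite -mem_path_block blockE mem_last.
case sE : (path_blocks s) => [//|w s'] /=; apply: contra iNs => /andP[/eqP + _].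
by rewrite tag_last => ->; rewrite -mem_path_blocks sE mem_head.
Qed.

Definition multi_fan_paths : seq U := path_blocks (enum 'I_r).

Lemma multi_fan_paths_sorted :
  sorted (fun u w => vertex_rank u < vertex_rank w)%N multi_fan_paths.
Proof.
apply: path_blocks_sorted.
by rewrite -(sorted_map (f := val) (e' := ltn)) val_enum_ord iota_ltn_sorted.
Qed.

Lemma mem_multi_fan_paths u : u \in multi_fan_paths.
Proof. by rewrite mem_path_blocks mem_enum. Qed.

Lemma size_multi_fan_paths : size multi_fan_paths = P.
Proof.
rewrite size_flatten /shape -map_comp sumnE big_map big_enum.
by apply: eq_bigr => i _; rewrite /= size_map size_enum_ord.
Qed.

Lemma card_multi_fan_paths : #|{: U}| = P.
Proof.
rewrite card_tagged sumnE big_map big_enum.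
by apply: eq_bigr => i _; rewrite card_ord.
Qed.

Lemma leq_num_paths : (r <= P)%N.
Proof.
by rewrite -[leqLHS]card_ord -sum1_card; apply: leq_sum => i _; apply: p_ge1.
Qed.

Lemma adj_count_multi_fan_paths : adj_count e multi_fan_paths = (P - r)%N.
Proof.
rewrite adj_count_path_blocks ?enum_uniq // big_enum /=.
rewrite -[X in (_ - X)%N]card_ord -sum1_card -sumnB => [|i _]; last exact: p_ge1.
by apply: eq_bigr => i _; rewrite subn1.
Qed.

Lemma multi_fan_hilbert (K : fieldType) (le : rel (multi_fan_vertex p)) : total le ->
  is_hilbert_series (bei K le (multi_fan p) : idealr _)
    (fun k => series_frac ((1 + 'X) ^+ (P - r)) (P + r) k
            + series_frac ((P%:R - 1)%:P * 'X^2 + 2%:P * 'X) (P + 2) k).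
Proof.
move=> le_total k; exists (size (nforms e false multi_fan_paths k)
    + size (cone_index {: U} k))%N.
  exact (cone_component_dim disjoint_paths_sym multi_fan_paths_sorted
    mem_multi_fan_paths disjoint_paths_rank K k le_total).
rewrite PoszD series_nforms adj_count_multi_fan_paths size_multi_fan_paths.
(* The subtractions are truncated, so this uses r <= P, which holds as every path has a vertex. *)
have -> : (2 * P - (P - r) = P + r)%N by have := leq_num_paths; lia.
congr (_ + _); rewrite size_cone_index card_multi_fan_paths.
rewrite series_fracD !series_fracC expr2 -['X]mul1r; case: k => [|j].
  by rewrite mulrA !series_fracX0 !mulr0.
rewrite mul1r !series_fracXS addn2.
rewrite -{2}['X]mul1r series_fracXS series_frac1.
have -> : series_frac 'X P.+2 j = 'C(j + P, P.+1)%:Z.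
  rewrite -['X]mul1r; case: j => [|j]; first by rewrite series_fracX0 bin_small.
  by rewrite series_fracXS series_frac1 addSnnS.
(* With (P + 1) C(j+P, P+1) = j C(j+P, P) and Pascal's rule, (P - 1) C(j+P, P+1) + 2 C(j+P+1, P+1)
   becomes (j + 2) C(j+P, P). *)
have := mul_bin_left (j + P) P; rewrite addnK.
have -> : 'C(j + P, j) = 'C(j + P, P) by rewrite -bin_sub ?leq_addr // addKn.
by rewrite addnS binS; lia.
Qed.

End MultiFanPaths.

Theorem corollary4p5 (K : fieldType) (r : nat) (p : 'I_r -> nat)
    (r_ge2 : (2 <= r)%N) (p_ge1 : forall i, (1 <= p i)%N)
    (le : rel (multi_fan_vertex p))
    (le_total : total le) (le_anti : antisymmetric le)
    (le_trans : transitive le) :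
  let J := bei K le (multi_fan p) in
  let P := (\sum_(i < r) p i)%N in
  [/\ is_hilbert_series J
        (fun k => series_frac ((1 + 'X) ^+ (P - r)) (P + r) k
                + series_frac ((P%:R - 1)%:P * 'X^2 + 2%:P * 'X) (P + 2) k),
      has_krull_dim {ideal_quot J} (P + r)
    & is_multiplicity J
        (if (2 < r)%N then 2 ^+ (P - r) else 2 ^+ (P - r) + P%:Z + 1)].
Proof.
move=> J P; have hilb := multi_fan_hilbert p_ge1 K le_total; rewrite -/P -/J in hilb.
(* The numerator over the common denominator (1-t)^(P+r); the second fraction is expanded by
   (1-t)^(r-2). *)
pose Q : {poly int} := (1 + 'X) ^+ (P - r) +
  ((P%:R - 1)%:P * 'X^2 + 2%:P * 'X) * (1 - 'X) ^+ (r - 2).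
have hilbQ : is_hilbert_series J (series_frac Q (P + r)).
  move=> k; have [d dimd Hd] := hilb k; exists d => //; rewrite -Hd /Q.
  rewrite [LHS]series_fracD; congr (_ + _).
  have -> : (P + r = P + 2 + (r - 2))%N by lia.
  exact: series_frac_1subXn.
have krull : has_krull_dim {ideal_quot J} (P + r).
  split; first by rewrite addnC; apply: multi_fan_prime_chain.
  by move=> m; apply: hilbert_prime_chain_le hilbQ.
split=> //; exists (P + r)%N, Q; split=> //.
rewrite /Q !(hornerE, horner_exp) /= subrr !mulr1.
(* At t = 1 the second summand vanishes for r > 2, while for r = 2 it contributes (P - 1) + 2 = P +
   1. *)
have [lt2r|ler2] := ltnP 2 r.
  by rewrite expr0n subn_eq0 leqNgt lt2r mulr0 addr0.
have -> : (r - 2 = 0)%N by lia.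
by rewrite expr0 mulr1 (natz P) subrK addrA.
Qed.
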